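(* Let $K\ge 1$, $k=(K-1)/(K+1)$, and let $p,m\ge 1$ be integers. Let $r_{p,m,k}\in(0,1)$ be the smallest positive root of the equation $$\frac{2r^{p}}{1-r^p}+2k\left(\frac{r^{m}}{1-r^m}+\log(1-r^m)\right)-1=0 .$$ Let $f(z)=h(z)+\overline{g(z)}=\sum_{n=0}^\infty a_n z^n+\overline{\sum_{n=2}^\infty b_n z^n}$ be a sense-preserving $K$-quasiconformal harmonic mapping in $\mathbb{D}$ with $h$ bounded in $\mathbb{D}$, and let $(\omega_j)_{j\ge 1}$ be functions with $\omega_j\in\mathcal{B}_j$ for each $j\geq 1$. Then $$\sum_{n=0}^\infty |a_n|\,|\omega_p(z)|^n+\sum_{n=2}^\infty |b_n|\,|\omega_m(z)|^n\le \Vert h\Vert_\infty\qquad\text{for } |z|=r\le \min\left\{r_{p,m,k},\,1/\sqrt[m]{3}\right\}.$$ Moreover, if $r_{p,m,k}\le 1/\sqrt[m]{3}$, then the number $r_{p,m,k}$ cannot be improved: for every $R$ with $r_{p,m,k}<R<1$ there exist a sense-preserving $K$-quasiconformal harmonic mapping $f(z)=h(z)+\overline{g(z)}=\sum_{n=0}^\infty a_n z^n+\overline{\sum_{n=2}^\infty b_n z^n}$ in $\mathbb{D}$ with $h$ bounded in $\mathbb{D}$, functions $(\omega_j)_{j\ge1}$ with $\omega_j\in\mathcal{B}_j$ for each $j\ge1$ (for the same $K,p,m$), and a point $z$ with $|z|\le R$ for which the displayed inequality $\sum_{n=0}^\infty |a_n|\,|\omega_p(z)|^n+\sum_{n=2}^\infty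 |b_n|\,|\omega_m(z)|^n\le \Vert h\Vert_\infty$ fails.
   Context: $\mathbb{D}=\{z\in\mathbb{C}:|z|<1\}$. For an analytic function $h$ in $\mathbb{D}$, $\Vert h\Vert_\infty=\sup_{z\in\mathbb{D}}|h(z)|$. $\mathcal{B}$ is the set of analytic functions $\omega$ in $\mathbb{D}$ with $\Vert\omega\Vert_\infty\le 1$, and for an integer $j\ge1$, $$\mathcal{B}_j=\{\omega\in\mathcal{B}:\ \omega(0)=\omega'(0)=\cdots=\omega^{(j-1)}(0)=0,\ \omega^{(j)}(0)\ne 0\}.$$ A harmonic mapping in $\mathbb{D}$ is written $f=h+\overline{g}$ with $h,g$ analytic in $\mathbb{D}$. It is locally univalent and sense-preserving if $|h'(z)|^2-|g'(z)|^2>0$ for all $z\in\mathbb{D}$ (in particular $h'\neq0$ in $\mathbb{D}$). For $K\ge1$ and $k=(K-1)/(K+1)\in[0,1)$, a locally univalent sense-preserving harmonic mapping $f=h+\overline g$ is called a sense-preserving $K$-quasiconformal harmonic mapping in $\mathbb{D}$ if $|g'(z)/h'(z)|\le k$ for all $z\in\mathbb{D}$. *)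

(* Defs.v *)
From Stdlib Require Import Reals.
From Coquelicot Require Import Coquelicot.
Open Scope R_scope.

Definition in_disc (z : C) : Prop := Cmod z < 1.

Definition is_power_series_from (N : nat) (a : nat -> C) (z l : C) : Prop :=
  is_series (K := C_AbsRing) (V := C_NormedModule)
    (fun n : nat => (a (N + n)%nat * z ^ (N + n))%C) l.

(** The sum of [|a_n| r^n] over [n >= N], with value [p_infty] when the series
    diverges: for [0 <= r] the partial sums are nondecreasing, so [Lim_seq] is
    their limit in [[0, +oo]]. *)
Definition abs_power_series_from (N : nat) (a : nat -> C) (r : R) : Rbar :=
  Lim_seq (sum_n (fun n : nat => Cmod (a (N + n)%nat) * r ^ (N + n))).

(** Functions on the disc are total functions on [C], and their values off the
    disc are irrelevant: the radius [e] may depend on [z0] and may be taken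
    small enough for the ball around [z0] to stay in the disc. *)
Definition analytic_in_disc (f : C -> C) : Prop :=
  forall z0 : C, in_disc z0 ->
    exists (c : nat -> C) (e : R), 0 < e /\
      forall z : C, Cmod (z - z0) < e ->
        is_power_series_from 0 c (z - z0)%C (f z).

Definition sup_norm (f : C -> C) : Rbar :=
  Lub_Rbar (fun x : R => exists z : C, in_disc z /\ x = Cmod (f z)).

Definition bounded_in_disc (f : C -> C) : Prop :=
  exists M : R, forall z : C, in_disc z -> Cmod (f z) <= M.

(** [C_derive] takes the limit of the difference quotient along the real
    direction; it is the complex derivative wherever the latter exists
    ([is_C_derive_unique]), hence on the disc for analytic functions. *)
Definition C_derive_n (n : nat) (f : C -> C) : C -> C := Nat.iter n C_derive f.

Definition class_B (w : C -> C) : Prop :=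
  analytic_in_disc w /\ Rbar_le (sup_norm w) (Finite 1).

Definition class_B_order (j : nat) (w : C -> C) : Prop :=
  class_B w /\
  (forall i : nat, (i < j)%nat -> C_derive_n i w (RtoC 0) = RtoC 0) /\
  C_derive_n j w (RtoC 0) <> RtoC 0.

Definition harmonic_mapping (f h g : C -> C) : Prop :=
  analytic_in_disc h /\ analytic_in_disc g /\
  forall z : C, in_disc z -> f z = (h z + Cconj (g z))%C.

Definition loc_univ_sense_preserving (f h g : C -> C) : Prop :=
  harmonic_mapping f h g /\
  forall z : C, in_disc z ->
    Cmod (C_derive h z) ^ 2 - Cmod (C_derive g z) ^ 2 > 0.

Definition sense_preserving_qc_harmonic (K : R) (f h g : C -> C) : Prop :=
  loc_univ_sense_preserving f h g /\
  forall z : C, in_disc z ->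
    Cmod (C_derive g z / C_derive h z) <= (K - 1) / (K + 1).

Definition has_expansions (h g : C -> C) (a b : nat -> C) : Prop :=
  forall z : C, in_disc z ->
    is_power_series_from 0 a z (h z) /\ is_power_series_from 2 b z (g z).

Definition radius_eq_lhs (p m : nat) (k r : R) : R :=
  2 * r ^ p / (1 - r ^ p)
  + 2 * k * (r ^ m / (1 - r ^ m) + ln (1 - r ^ m)) - 1.

Definition is_smallest_root (p m : nat) (k r : R) : Prop :=
  0 < r < 1 /\ radius_eq_lhs p m k r = 0 /\
  forall s : R, 0 < s < r -> radius_eq_lhs p m k s <> 0.

Definition bohr_inequality (h : C -> C) (a b : nat -> C) (x y : R) : Prop :=
  Rbar_le
    (Rbar_plus (abs_power_series_from 0 a x) (abs_power_series_from 2 b y))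
    (sup_norm h).

(* Main.v *)
Require Import Defs.
From Stdlib Require Import Reals Lra Lia Psatz Ranalysis5 Classical ClassicalEpsilon List.
From Coquelicot Require Import Coquelicot.
Open Scope R_scope.

(** Let [H] be the norm of [h] and [t = |a_0|]. For the inequality, the
    coefficients of [h] satisfy [|a_n| <= (H^2 - t^2) / H] for [n >= 1]
    ([bounded_coef]). Since [g'] vanishes at the origin and is dominated by
    [k |h'|], the Schwarz lemma gives [g' = z phi h'] with [|phi| <= k]
    ([dominated_factorization]), and Bohr's theorem for [phi]
    ([bohr_radius_third]) turns this into the majorization of
    [sum n |b_n| y^(n-1)] by [k sum n |a_n| y^n] for [y <= 1/3]. Dividing the
    coefficients by [n], that is, integrating, yields
    [sum |b_n| y^n <= k (H^2 - t^2) / H * (y / (1 - y) + log (1 - y))]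
    ([coanalytic_partial_sum]). As [|omega_j z| <= |z|^j], both sums together
    are at most [t + (H^2 - t^2) / (2 H) <= H] as long as the left side of the
    radius equation, which is increasing in [r], is not positive.

    All of this rests on the maximum principle, used in the form that dividing a
    function by [z^n] preserves a bound on the unit disc ([schwarz_quotient]).
    The functions met on the way, such as [g' / h'] or Moebius transforms of
    averages of [h], are quotients of analytic functions. Instead of power
    series they carry only expansions of every finite order at each point
    ([taylor]), a property clearly inherited by quotients. That is enough:
    where [|f|^2 + eps |z|^2] is maximal, averaging [f] over four points around
    the centre removes the terms of order one and two, so the positive
    contribution [eps |w|^2] cannot be compensated ([no_interior_max]).

    Equality holds in the limit for [h = (alpha - z) / (1 - alpha z)] and
    [g' = k z h'] as [alpha] tends to [1], with [omega_j = z^j]. Beyond the root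
    the sums then exceed [1] by a fixed amount depending on [alpha], which is
    not lost when the Taylor series of [h] is cut off at a high degree; this
    makes [h] and [g] polynomials. *)

(** * Finite Taylor expansions *)

Definition near0 (P : C -> Prop) : Prop :=
  exists e : R, 0 < e /\ forall w : C, Cmod w < e -> P w.

Lemma near0_and (P Q : C -> Prop) :
  near0 P -> near0 Q -> near0 (fun w => P w /\ Q w).
Proof.
  intros [e [He HP]] [d [Hd HQ]].
  exists (Rmin e d); split; [now apply Rmin_glb_lt|].
  intros w Hw; split; [apply HP | apply HQ];
    (eapply Rlt_le_trans; [exact Hw|]); [apply Rmin_l | apply Rmin_r].
Qed.

Lemma near0_imp (P Q : C -> Prop) :
  (forall w, P w -> Q w) -> near0 P -> near0 Q.
Proof. intros H [e [He HP]]; exists e; auto. Qed.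

Lemma near0_all (P : C -> Prop) : (forall w, P w) -> near0 P.
Proof. intros H; exists 1; split; [lra | auto]. Qed.

Lemma near0_at0 (P : C -> Prop) : near0 P -> P (RtoC 0).
Proof. intros [e [He HP]]; apply HP; rewrite Cmod_0; exact He. Qed.

(** The expansion [f w = c_0 + c_1 w + ... + c_(n-1) w^(n-1) + O(w^n)], unrolled
    one coefficient at a time so that its algebra can be done by induction. *)
Fixpoint jet (n : nat) (c : nat -> C) (f : C -> C) : Prop :=
  match n with
  | O => exists M : R, near0 (fun w => Cmod (f w) <= M)
  | S n' => exists f1 : C -> C,
      near0 (fun w => f w = (c 0%nat + w * f1 w)%C) /\
      jet n' (fun i => c (S i)) f1
  end.

Lemma jet_ext (n : nat) : forall (c d : nat -> C) (f g : C -> C),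
  (forall i, (i < n)%nat -> c i = d i) -> near0 (fun w => f w = g w) ->
  jet n c f -> jet n d g.
Proof.
  induction n as [|n IH]; intros c d f g Hcd Hfg.
  - intros [M HM]; exists M.
    refine (near0_imp _ _ _ (near0_and _ _ Hfg HM)).
    intros w [E H]; now rewrite <- E.
  - intros [f1 [Hf1 Hj]]; exists f1; split.
    + refine (near0_imp _ _ _ (near0_and _ _ Hfg Hf1)).
      intros w [E H]; rewrite <- E, H, (Hcd 0%nat); [reflexivity | lia].
    + apply (IH (fun i => c (S i)) _ f1); [| now apply near0_all | exact Hj].
      intros i Hi; apply Hcd; lia.
Qed.

Lemma jet_bounded (n : nat) : forall (c : nat -> C) (f : C -> C),
  jet n c f -> exists M : R, 0 < M /\ near0 (fun w => Cmod (f w) <= M).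
Proof.
  induction n as [|n IH]; intros c f.
  - intros [M HM]; exists (Rmax M 1); split.
    + eapply Rlt_le_trans; [apply Rlt_0_1 | apply Rmax_r].
    + revert HM; apply near0_imp; intros w H.
      eapply Rle_trans; [exact H | apply Rmax_l].
  - intros [f1 [Hf Hj]]; destruct (IH _ _ Hj) as [M [HM0 HM]].
    exists (Cmod (c 0%nat) + M); split; [pose proof (Cmod_ge_0 (c 0%nat)); lra|].
    assert (H1 : near0 (fun w => Cmod w <= 1)).
    { exists 1; split; [lra | intros; lra]. }
    refine (near0_imp _ _ _ (near0_and _ _ Hf (near0_and _ _ HM H1))).
    intros w [E [H Hw]]; rewrite E.
    eapply Rle_trans; [apply Cmod_triangle|].
    rewrite Cmod_mult.
    pose proof (Cmod_ge_0 w); pose proof (Cmod_ge_0 (f1 w)); nra.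
Qed.

Lemma jet_weaken (n : nat) : forall (c : nat -> C) (f : C -> C),
  jet (S n) c f -> jet n c f.
Proof.
  induction n as [|n IH]; intros c f Hj.
  - destruct (jet_bounded _ _ _ Hj) as [M [_ HM]]; now exists M.
  - destruct Hj as [f1 [Hf Hj]]; exists f1; split; auto.
Qed.

Lemma jet_le (n m : nat) (c : nat -> C) (f : C -> C) :
  (n <= m)%nat -> jet m c f -> jet n c f.
Proof. intros H; induction H; auto; intros; apply IHle, jet_weaken; auto. Qed.

Lemma jet_at0 (n : nat) (c : nat -> C) (f : C -> C) :
  jet (S n) c f -> f (RtoC 0) = c 0%nat.
Proof. intros [f1 [Hf _]]; rewrite (near0_at0 _ Hf); ring. Qed.

Lemma jet_plus (n : nat) : forall (c d : nat -> C) (f g : C -> C),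
  jet n c f -> jet n d g ->
  jet n (fun i => (c i + d i)%C) (fun w => (f w + g w)%C).
Proof.
  induction n as [|n IH]; intros c d f g.
  - intros [M HM] [N HN]; exists (M + N).
    refine (near0_imp _ _ _ (near0_and _ _ HM HN)).
    intros w [H1 H2]; eapply Rle_trans; [apply Cmod_triangle | lra].
  - intros [f1 [Hf Hjf]] [g1 [Hg Hjg]]; exists (fun w => (f1 w + g1 w)%C); split.
    + refine (near0_imp _ _ _ (near0_and _ _ Hf Hg)).
      intros w [H1 H2]; rewrite H1, H2; ring.
    + exact (IH _ _ _ _ Hjf Hjg).
Qed.

Lemma jet_scal (n : nat) (a : C) : forall (c : nat -> C) (f : C -> C),
  jet n c f -> jet n (fun i => (a * c i)%C) (fun w => (a * f w)%C).
Proof.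
  induction n as [|n IH]; intros c f.
  - intros [M HM]; exists (Cmod a * M).
    revert HM; apply near0_imp; intros w H; rewrite Cmod_mult.
    apply Rmult_le_compat_l; [apply Cmod_ge_0 | exact H].
  - intros [f1 [Hf Hj]]; exists (fun w => (a * f1 w)%C); split; [|exact (IH _ _ Hj)].
    revert Hf; apply near0_imp; intros w H; rewrite H; ring.
Qed.

Definition const_coef (a : C) (i : nat) : C :=
  match i with O => a | S _ => RtoC 0 end.

Lemma jet_const (n : nat) (a : C) : jet n (const_coef a) (fun _ => a).
Proof.
  assert (H0 : forall m, jet m (fun _ => RtoC 0) (fun _ => RtoC 0)).
  { induction m as [|m IH].
    - exists 0; apply near0_all; intros; rewrite Cmod_0; lra.
    - exists (fun _ => RtoC 0); split; [apply near0_all; intros; ring | exact IH]. }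
  destruct n as [|n].
  - exists (Cmod a); apply near0_all; intros; lra.
  - exists (fun _ => RtoC 0); split; [apply near0_all; intros; simpl; ring | exact (H0 n)].
Qed.

(** Coefficients of a product of power series. Splitting off the leading
    coefficient of the first factor makes the recursion match that of [jet]. *)
Fixpoint conv (c d : nat -> C) (n : nat) : C :=
  match n with
  | O => (c 0%nat * d 0%nat)%C
  | S n' => (c 0%nat * d (S n') + conv (fun i => c (S i)) d n')%C
  end.

Lemma jet_mult (n : nat) : forall (c d : nat -> C) (f g : C -> C),
  jet n c f -> jet n d g -> jet n (conv c d) (fun w => (f w * g w)%C).
Proof.
  induction n as [|n IH]; intros c d f g.
  - intros Hf Hg.
    destruct (jet_bounded 0 c f Hf) as [M [HM0 HM]].
    destruct (jet_bounded 0 d g Hg) as [N [HN0 HN]].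
    exists (M * N); refine (near0_imp _ _ _ (near0_and _ _ HM HN)).
    intros w [H1 H2]; rewrite Cmod_mult.
    apply Rmult_le_compat; auto using Cmod_ge_0.
  - intros [f1 [Hf Hjf]] Hjg0.
    pose proof (jet_weaken _ _ _ Hjg0) as Hjgw.
    destruct Hjg0 as [g1 [Hg Hjg]].
    exists (fun w => (c 0%nat * g1 w + f1 w * g w)%C); split.
    + refine (near0_imp _ _ _ (near0_and _ _ Hf Hg)).
      intros w [H1 H2]; rewrite H1.
      transitivity (c 0%nat * g w + w * f1 w * g w)%C; [ring|].
      rewrite H2 at 1; simpl; ring.
    + exact (jet_plus _ _ _ _ _ (jet_scal _ (c 0%nat) _ _ Hjg)
                      (IH _ _ _ _ Hjf Hjgw)).
Qed.

(** The recursion [1 / f = 1 / c_0 - w (f1 / c_0) (1 / f)], for [f = c_0 + w f1],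
    expresses each order of the expansion of [1 / f] through the previous one. *)
Lemma jet_inv (n : nat) (delta : R) : forall (c : nat -> C) (f : C -> C),
  0 < delta -> near0 (fun w => delta <= Cmod (f w)) ->
  jet n c f -> exists d : nat -> C, jet n d (fun w => (/ f w)%C).
Proof.
  induction n as [|n IH]; intros c f Hd Hlow Hj.
  - exists c, (/ delta); revert Hlow; apply near0_imp; intros w H.
    assert (Hf : f w <> RtoC 0) by (apply Cmod_gt_0; lra).
    rewrite Cmod_inv by exact Hf; apply Rinv_le_contravar; lra.
  - destruct (IH c f Hd Hlow (jet_weaken _ _ _ Hj)) as [d Hjd].
    assert (H0 : c 0%nat <> RtoC 0).
    { rewrite <- (jet_at0 _ _ _ Hj); apply Cmod_gt_0.
      apply Rlt_le_trans with (1 := Hd).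
      exact (near0_at0 (fun w => delta <= Cmod (f w)) Hlow). }
    destruct Hj as [f1 [Hf Hjf]].
    pose proof (jet_scal _ (- / c 0%nat)%C _ _ (jet_mult _ _ _ _ _ Hjf Hjd)) as Hq.
    match type of Hq with jet _ ?q _ =>
      exists (fun i => match i with O => (/ c 0%nat)%C | S j => q j end) end.
    eexists; split; [|exact Hq].
    refine (near0_imp _ _ _ (near0_and _ _ Hlow Hf)); simpl.
    intros w [H E].
    assert (Hw : f w <> RtoC 0) by (apply Cmod_gt_0; lra).
    assert (E1 : (w * f1 w = f w - c 0%nat)%C) by (rewrite E; ring).
    transitivity (/ c 0%nat - / c 0%nat * (w * f1 w) * / f w)%C; [|ring].
    rewrite E1; field; auto.
Qed.

Lemma Cmod_minus_sym (x y : C) : Cmod (x - y) = Cmod (y - x).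
Proof. rewrite <- Cmod_opp; f_equal; ring. Qed.

Lemma Cmod_triangle_inv (x y : C) : Cmod x - Cmod y <= Cmod (x + y).
Proof.
  pose proof (Cmod_triangle (x + y) (- y)) as H.
  rewrite Cmod_opp in H; replace (x + y + - y)%C with x in H by ring; lra.
Qed.

(** The remainders being bounded, letting [w] tend to [0] off the centre recovers
    one coefficient after the other. *)
Lemma jet_zero_coef (n : nat) : forall (c : nat -> C) (f : C -> C),
  jet n c f -> near0 (fun w => w <> RtoC 0 -> f w = RtoC 0) ->
  forall i, (i < n)%nat -> c i = RtoC 0.
Proof.
  induction n as [|n IH]; intros c f Hj Hz i Hi; [lia|].
  destruct Hj as [f1 [Hf Hj]].
  destruct (jet_bounded _ _ _ Hj) as [M [HM0 HM]].
  assert (H0 : c 0%nat = RtoC 0).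
  { destruct (near0_and _ _ Hz (near0_and _ _ Hf HM)) as [e [He H]].
    apply Cmod_eq_0, Rle_antisym; [|apply Cmod_ge_0].
    apply Rnot_lt_le; intros Hc.
    pose (t := Rmin (e / 2) (Cmod (c 0%nat) / (2 * M))).
    assert (Ht : 0 < t).
    { apply Rmin_glb_lt; [lra|]; apply Rdiv_lt_0_compat; lra. }
    assert (Ht1 : t <= e / 2) by apply Rmin_l.
    assert (Ht2 : t <= Cmod (c 0%nat) / (2 * M)) by apply Rmin_r.
    assert (Hmt : Cmod (RtoC t) = t) by (rewrite Cmod_R; apply Rabs_pos_eq; lra).
    destruct (H (RtoC t)) as [A [B D]]; [lra|].
    rewrite A in B.
    2:{ intros E; apply RtoC_inj in E; lra. }
    assert (Hc2 : Cmod (c 0%nat) = t * Cmod (f1 (RtoC t))).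
    { rewrite <- Hmt at 1; rewrite <- Cmod_mult, <- (Cmod_opp (_ * _)); f_equal.
      replace (c 0%nat) with (c 0%nat + t * f1 (RtoC t) - t * f1 (RtoC t))%C by ring.
      rewrite <- B; ring. }
    assert (t * M <= Cmod (c 0%nat) / 2).
    { apply Rmult_le_compat_r with (r := M) in Ht2; [|lra].
      replace (Cmod (c 0%nat) / (2 * M) * M) with (Cmod (c 0%nat) / 2) in Ht2
        by (field; lra); exact Ht2. }
    nra. }
  destruct i as [|i]; [exact H0|].
  apply (IH (fun i => c (S i)) f1 Hj); [|lia].
  refine (near0_imp _ _ _ (near0_and _ _ Hz Hf)); intros w [A B] Hw.
  rewrite (A Hw), H0 in B.
  assert (E : (w * f1 w = RtoC 0)%C) by (rewrite B; ring).
  transitivity (/ w * (w * f1 w))%C; [field; exact Hw | rewrite E; ring].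
Qed.

Lemma jet_unique (n : nat) (c d : nat -> C) (f g : C -> C) :
  jet n c f -> jet n d g -> near0 (fun w => w <> RtoC 0 -> f w = g w) ->
  forall i, (i < n)%nat -> c i = d i.
Proof.
  intros Hf Hg E i Hi.
  pose proof (jet_plus _ _ _ _ _ Hf (jet_scal _ (- (1))%C _ _ Hg)) as H.
  assert (Z : (c i + - (1) * d i)%C = RtoC 0).
  { refine (jet_zero_coef n _ _ H _ i Hi).
    revert E; apply near0_imp; intros w E Hw; rewrite (E Hw).
    ring. }
  replace (c i) with (c i + - (1) * d i + d i)%C by ring.
  rewrite Z; ring.
Qed.

Lemma jet_remainder (n m : nat) : forall (c : nat -> C) (f : C -> C),
  (forall i, (i < n)%nat -> c i = RtoC 0) -> jet (n + m) c f ->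
  exists f1 : C -> C,
    near0 (fun w => f w = (w ^ n * f1 w)%C) /\ jet m (fun i => c (n + i)%nat) f1.
Proof.
  induction n as [|n IH]; intros c f Hc Hj.
  - exists f; split; [apply near0_all; intros; simpl; ring | exact Hj].
  - destruct Hj as [f0 [Hf Hj]].
    destruct (IH (fun i => c (S i)) f0) as [f1 [Hf1 Hj1]].
    + intros i Hi; apply Hc; lia.
    + exact Hj.
    + exists f1; split; [|exact Hj1].
      refine (near0_imp _ _ _ (near0_and _ _ Hf Hf1)); intros w [A B].
      rewrite A, B, Hc by lia; simpl; ring.
Qed.

Lemma jet_rotate (n : nat) (zeta : C) (Hz : Cmod zeta = 1) :
  forall (c : nat -> C) (f : C -> C), jet n c f ->
  jet n (fun i => (zeta ^ i * c i)%C) (fun w => f (zeta * w)%C).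
Proof.
  assert (Hnear : forall P, near0 P -> near0 (fun w => P (zeta * w)%C)).
  { intros P [e [He HP]]; exists e; split; [exact He|].
    intros w Hw; apply HP; rewrite Cmod_mult, Hz; lra. }
  induction n as [|n IH]; intros c f.
  - intros [M HM]; exists M; exact (Hnear _ HM).
  - intros [f1 [Hf Hj]]; exists (fun w => (zeta * f1 (zeta * w))%C); split.
    + generalize (Hnear _ Hf); apply near0_imp; intros w E; rewrite E.
      simpl; ring.
    + refine (jet_ext n _ _ _ _ _ (near0_all _ (fun _ => eq_refl))
               (jet_scal n zeta _ _ (IH _ _ Hj))).
      intros i _; simpl; ring.
Qed.

(** Substitute for holomorphy at [z0]: its stability under quotients involves no
    convergence question, and it suffices for the maximum principle. *)
Definition taylor (f : C -> C) (z0 : C) : Prop :=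
  forall n : nat, exists c : nat -> C, jet n c (fun w => f (z0 + w)%C).

Lemma taylor_ext (f g : C -> C) (z0 : C) :
  near0 (fun w => f (z0 + w)%C = g (z0 + w)%C) -> taylor f z0 -> taylor g z0.
Proof.
  intros E H n; destruct (H n) as [c Hc]; exists c.
  exact (jet_ext n _ _ _ _ (fun _ _ => eq_refl) E Hc).
Qed.

Lemma taylor_const (a z0 : C) : taylor (fun _ => a) z0.
Proof. intros n; eexists; apply (jet_const n a). Qed.

Lemma taylor_id (z0 : C) : taylor (fun z => z) z0.
Proof.
  intros n; destruct n as [|n].
  - exists (const_coef z0), (Cmod z0 + 1); exists 1; split; [lra|].
    intros w Hw; eapply Rle_trans; [apply Cmod_triangle | lra].
  - exists (fun i => match i with O => z0 | S j => const_coef (RtoC 1) j end).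
    exists (fun _ => RtoC 1); split; [apply near0_all; intros; ring|].
    exact (jet_const n (RtoC 1)).
Qed.

Lemma taylor_plus (f g : C -> C) (z0 : C) :
  taylor f z0 -> taylor g z0 -> taylor (fun z => (f z + g z)%C) z0.
Proof.
  intros Hf Hg n; destruct (Hf n) as [c Hc]; destruct (Hg n) as [d Hd].
  eexists; exact (jet_plus _ _ _ _ _ Hc Hd).
Qed.

Lemma taylor_mult (f g : C -> C) (z0 : C) :
  taylor f z0 -> taylor g z0 -> taylor (fun z => (f z * g z)%C) z0.
Proof.
  intros Hf Hg n; destruct (Hf n) as [c Hc]; destruct (Hg n) as [d Hd].
  eexists; exact (jet_mult _ _ _ _ _ Hc Hd).
Qed.

Lemma taylor_pow (n : nat) (z0 : C) : taylor (fun z => (z ^ n)%C) z0.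
Proof.
  induction n as [|n IH]; [exact (taylor_const 1 z0)|].
  exact (taylor_mult _ _ _ (taylor_id z0) IH).
Qed.

Lemma taylor_lipschitz (f : C -> C) (z0 : C) :
  taylor f z0 ->
  exists M : R, 0 < M /\
    near0 (fun w => Cmod (f (z0 + w)%C - f z0) <= M * Cmod w).
Proof.
  intros Hf; destruct (Hf 1%nat) as [c Hj].
  pose proof (jet_at0 _ _ _ Hj) as E0; simpl in E0; rewrite Cplus_0_r in E0.
  destruct Hj as [f1 [Hf1 Hj]].
  destruct (jet_bounded _ _ _ Hj) as [M [HM0 HM]]; exists M; split; [exact HM0|].
  refine (near0_imp _ _ _ (near0_and _ _ Hf1 HM)); intros w [A B].
  rewrite A, E0; replace (c 0%nat + w * f1 w - c 0%nat)%C with (w * f1 w)%C by ring.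
  rewrite Cmod_mult; pose proof (Cmod_ge_0 w); nra.
Qed.

Lemma taylor_inv (f : C -> C) (z0 : C) :
  taylor f z0 -> f z0 <> RtoC 0 -> taylor (fun z => (/ f z)%C) z0.
Proof.
  intros Hf H0 n; destruct (Hf n) as [c Hc].
  apply Cmod_gt_0 in H0.
  apply (jet_inv n (Cmod (f z0) / 2) c); [lra | | exact Hc].
  destruct (taylor_lipschitz f z0 Hf) as [M [HM0 HM]].
  assert (Hs : near0 (fun w => M * Cmod w <= Cmod (f z0) / 2)).
  { exists (Cmod (f z0) / (2 * M)); split; [apply Rdiv_lt_0_compat; lra|].
    intros w Hw; apply Rlt_le.
    apply Rmult_lt_compat_l with (r := M) in Hw; [|exact HM0].
    replace (M * (Cmod (f z0) / (2 * M))) with (Cmod (f z0) / 2) in Hw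
      by (field; lra); exact Hw. }
  refine (near0_imp _ _ _ (near0_and _ _ HM Hs)); intros w [A B].
  pose proof (Cmod_triangle_inv (f z0) (f (z0 + w)%C - f z0)) as T.
  replace (f z0 + (f (z0 + w)%C - f z0))%C with (f (z0 + w)%C) in T by ring.
  lra.
Qed.

(** * The maximum principle *)

Lemma Cmod_le_abs_sum (x y : R) : Cmod (x, y) <= Rabs x + Rabs y.
Proof.
  replace (x, y) with (RtoC x + Ci * RtoC y)%C.
  - eapply Rle_trans; [apply Cmod_triangle|].
    rewrite Cmod_mult, Cmod_Ci, !Cmod_R; lra.
  - apply injective_projections; simpl; ring.
Qed.

Lemma list_max_exists {T : Type} (u : T -> R) (P : T -> Prop) (l : list T) :
  (exists t, In t l /\ P t) ->
  exists t, In t l /\ P t /\ forall s, In s l -> P s -> u s <= u t.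
Proof.
  induction l as [|a l IH]; intros [t [Ht HPt]]; [contradiction|].
  destruct (classic (exists s, In s l /\ P s)) as [Hl | Hl].
  - destruct (IH Hl) as [m [Hm [HPm Hmax]]].
    destruct (classic (P a /\ u m < u a)) as [[HPa Hlt] | Hna].
    + exists a; repeat split; [now left | exact HPa |].
      intros s [<- | Hs] HPs; [lra | specialize (Hmax s Hs HPs); lra].
    + exists m; repeat split; [now right | exact HPm |].
      intros s [<- | Hs] HPs; [|auto].
      apply Rnot_lt_le; intros H; apply Hna; split; assumption.
  - exists t; repeat split; [exact Ht | exact HPt |].
    assert (Honly : forall s, In s (a :: l) -> P s -> s = a).
    { intros s [<- | Hs] HPs; [reflexivity|]; exfalso; apply Hl; eauto. }
    intros s Hs HPs; rewrite (Honly s Hs HPs), (Honly t Ht HPt); lra.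
Qed.

(** If no point were maximal, each point [t] would have a neighbourhood on which
    [u] stays below its value at one point [p t]; among the points [p t] of a
    finite subcover the best one would lie in some neighbourhood, and thus be
    beaten by another. *)
Lemma closed_disc_max (u : C -> R) (rho : R) :
  0 <= rho ->
  (forall z, Cmod z <= rho -> forall eps, 0 < eps ->
     near0 (fun w => Rabs (u (z + w)%C - u z) < eps)) ->
  exists z0, Cmod z0 <= rho /\ forall z, Cmod z <= rho -> u z <= u z0.
Proof.
  intros Hrho Hcont; apply NNPP; intros Hno.
  assert (Hbeat : forall z0, Cmod z0 <= rho ->
            exists z, Cmod z <= rho /\ u z0 < u z).
  { intros z0 Hz0; apply NNPP; intros H; apply Hno; exists z0; split; [exact Hz0|].
    intros z Hz; apply Rnot_lt_le; intros Hlt; apply H; eauto. }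
  assert (Hloc : forall t : C, exists dp : posreal * C,
    (Cmod t <= rho -> Cmod (snd dp) <= rho /\
       forall z, Cmod (z - t) < 2 * fst dp -> u z < u (snd dp)) /\
    (rho < Cmod t -> forall z, Cmod (z - t) < 2 * fst dp -> rho < Cmod z)).
  { intros t; destruct (Rle_lt_dec (Cmod t) rho) as [Ht | Ht].
    - destruct (Hbeat t Ht) as [p [Hp Hup]].
      destruct (Hcont t Ht (u p - u t)) as [e [He Hc]]; [lra|].
      exists (pos_div_2 (mkposreal e He), p); simpl; split; [|lra].
      intros _; split; [exact Hp|]; intros z Hz.
      assert (Hz' : Cmod (z - t) < e) by lra.
      specialize (Hc _ Hz'); replace (t + (z - t))%C with z in Hc by ring.
      apply Rabs_def2 in Hc; lra.
    - assert (He : 0 < Cmod t - rho) by lra.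
      exists (pos_div_2 (mkposreal _ He), t); simpl; split; [lra|].
      intros _ z Hz; pose proof (Cmod_triangle_inv t (z - t)) as H.
      replace (t + (z - t))%C with z in H by ring; lra. }
  pose (sel := fun t => proj1_sig (constructive_indefinite_description _ (Hloc t))).
  assert (Hsel : forall t : C,
    (Cmod t <= rho -> Cmod (snd (sel t)) <= rho /\
       forall z, Cmod (z - t) < 2 * fst (sel t) -> u z < u (snd (sel t))) /\
    (rho < Cmod t -> forall z, Cmod (z - t) < 2 * fst (sel t) -> rho < Cmod z)).
  { intros t; exact (proj2_sig (constructive_indefinite_description _ (Hloc t))). }
  pose (pt := fun t : Compactness.Tn 2 R => (fst t, fst (snd t)) : C).
  apply (compactness_list 2 (- rho, (- rho, tt)) (rho, (rho, tt))
           (fun t => fst (sel (pt t)))).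
  intros [l Hl].
  assert (Hcover : forall z, Cmod z <= rho -> exists t, In t l /\
            Cmod (pt t) <= rho /\ u z < u (snd (sel (pt t)))).
  { intros z Hz.
    assert (H1 : Rabs (fst z) <= rho /\ Rabs (snd z) <= rho).
    { pose proof (Rmax_Cmod z) as H.
      pose proof (Rmax_l (Rabs (fst z)) (Rabs (snd z))).
      pose proof (Rmax_r (Rabs (fst z)) (Rabs (snd z))); lra. }
    destruct H1 as [H1 H2]; apply Rabs_le_between in H1; apply Rabs_le_between in H2.
    destruct (Hl (fst z, (snd z, tt))) as [t [Hin [_ Hclose]]].
    { simpl; repeat split; lra. }
    destruct t as [t1 [t2 []]]; simpl in Hclose.
    destruct Hclose as [C1 [C2 _]].
    assert (Hd : Cmod (z - pt (t1, (t2, tt))) < 2 * fst (sel (pt (t1, (t2, tt))))).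
    { destruct z as [x y]; unfold pt in *; simpl in *.
      eapply Rle_lt_trans; [apply Cmod_le_abs_sum|]; simpl; unfold Rminus in *; lra. }
    exists (t1, (t2, tt)); split; [exact Hin|].
    destruct (Hsel (pt (t1, (t2, tt)))) as [S1 S2].
    destruct (Rle_lt_dec (Cmod (pt (t1, (t2, tt)))) rho) as [Ht | Ht].
    - split; [exact Ht|]; now apply S1.
    - specialize (S2 Ht z Hd); lra. }
  destruct (list_max_exists (fun t => u (snd (sel (pt t))))
             (fun t => Cmod (pt t) <= rho) l) as [m [Hm [HPm Hmax]]].
  { destruct (Hcover (RtoC 0)) as [t [A [B _]]]; [now rewrite Cmod_0 | eauto]. }
  destruct (Hcover (snd (sel (pt m)))) as [t [A [B D]]].
  { apply Hsel; exact HPm. }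
  specialize (Hmax t A B); simpl in Hmax; lra.
Qed.

Lemma Cmod_sqr (x y : R) : Cmod (x, y) ^ 2 = x ^ 2 + y ^ 2.
Proof.
  unfold Cmod; simpl fst; simpl snd; rewrite pow2_sqrt; [reflexivity | nra].
Qed.

(** Summing over [t], [i t], [-t], [-i t] cancels the terms of order one and two
    of the expansion of [f], so the mean of [|f|^2] over these points is at least
    [|f z0|^2 - O(t^3)], while that of [eps |z|^2] exceeds its value at [z0] by
    [eps t^2]. *)
Lemma no_interior_max (f : C -> C) (z0 : C) (eps d : R) :
  taylor f z0 -> 0 < eps -> 0 < d ->
  (forall z, Cmod (z - z0) < d ->
     Cmod (f z) ^ 2 + eps * Cmod z ^ 2 <= Cmod (f z0) ^ 2 + eps * Cmod z0 ^ 2) ->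
  False.
Proof.
  intros Hf Heps Hd Hmax.
  destruct (Hf 3%nat) as [c Hj].
  pose proof (jet_at0 _ _ _ Hj) as E0; simpl in E0; rewrite Cplus_0_r in E0.
  destruct (jet_remainder 3 0 (fun i => match i with 0 | 1 | 2 => RtoC 0 | _ => c i end)%nat
     (fun w => f (z0 + w) - (c 0%nat + w * (c 1%nat + w * c 2%nat)))%C)
    as [f3 [Hf3 [M HM]]].
  { intros [|[|[|i]]] Hi; trivial; lia. }
  { destruct Hj as [f1 [A1 [f2 [A2 [f3 [A3 Hj3]]]]]].
    simpl; exists (fun w => w * (w * f3 w))%C; split.
    - refine (near0_imp _ _ _ (near0_and _ _ A1 (near0_and _ _ A2 A3))).
      intros w [B1 [B2 B3]]; rewrite B1, B2, B3; ring.
    - exists (fun w => w * f3 w)%C; split; [apply near0_all; intros; ring|].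
      exists f3; split; [apply near0_all; intros; ring | exact Hj3]. }
  destruct (near0_and _ _ Hf3 HM) as [e [He Hexp]].
  set (a := Cmod (c 0%nat)).
  assert (Ha : 0 <= a) by apply Cmod_ge_0.
  set (N := Rabs M + 1).
  assert (HN : 0 < N) by (pose proof (Rabs_pos M); unfold N; lra).
  assert (HNM : M <= N) by (pose proof (Rle_abs M); unfold N; lra).
  pose (t := Rmin (Rmin e d / 2) (eps / (2 * (2 * a * N + 1)))).
  assert (Hden : 0 < 2 * a * N + 1) by nra.
  assert (Ht : 0 < t).
  { apply Rmin_glb_lt; [pose proof (Rmin_glb_lt e d 0 He Hd); lra|].
    apply Rdiv_lt_0_compat; lra. }
  assert (Hte : t < e /\ t < d).
  { assert (t <= Rmin e d / 2) by apply Rmin_l.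
    pose proof (Rmin_l e d); pose proof (Rmin_r e d); split; lra. }
  assert (Hteps : t * (2 * a * N + 1) < eps).
  { assert (H : t <= eps / (2 * (2 * a * N + 1))) by apply Rmin_r.
    apply Rmult_le_compat_r with (r := 2 * a * N + 1) in H; [|lra].
    replace (eps / (2 * (2 * a * N + 1)) * (2 * a * N + 1)) with (eps / 2) in H
      by (field; lra); lra. }
  assert (Hpt : forall w, Cmod w = t ->
     Cmod (f (z0 + w)%C) ^ 2 + eps * Cmod (z0 + w) ^ 2 <= a ^ 2 + eps * Cmod z0 ^ 2
     /\ exists r, f (z0 + w)%C = (c 0%nat + w * (c 1%nat + w * c 2%nat) + r)%C
                  /\ Cmod r <= t ^ 3 * N).
  { intros w Hw; split.
    - unfold a; rewrite <- E0; apply Hmax.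
      replace (z0 + w - z0)%C with w by ring; lra.
    - destruct (Hexp w) as [A B]; [lra|].
      exists (w ^ 3 * f3 w)%C; split.
      + rewrite <- A; ring.
      + rewrite Cmod_mult, Cmod_pow, Hw.
        apply Rmult_le_compat_l; [apply pow_le; lra | lra]. }
  assert (Hmt : Cmod (RtoC t) = t) by (rewrite Cmod_R; apply Rabs_pos_eq; lra).
  destruct (Hpt (RtoC t) Hmt) as [U1 [r1 [F1 R1]]].
  destruct (Hpt (Ci * t)%C) as [U2 [r2 [F2 R2]]].
  { rewrite Cmod_mult, Cmod_Ci, Hmt; ring. }
  destruct (Hpt (- t)%C) as [U3 [r3 [F3 R3]]]; [now rewrite Cmod_opp|].
  destruct (Hpt (- (Ci * t))%C) as [U4 [r4 [F4 R4]]].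
  { rewrite Cmod_opp, Cmod_mult, Cmod_Ci, Hmt; ring. }
  assert (Hsum : (f (z0 + t) + f (z0 + Ci * t) + f (z0 + - t) + f (z0 + - (Ci * t))
                  = 4 * c 0%nat + (r1 + r2 + r3 + r4))%C).
  { rewrite F1, F2, F3, F4.
    assert (HCi : (Ci * Ci = - (1))%C).
    { apply injective_projections; simpl; ring. }
    transitivity (4 * c 0%nat + (2 + 2 * (Ci * Ci)) * (t * t * c 2%nat)
                  + (r1 + r2 + r3 + r4))%C; [ring|].
    rewrite HCi; ring. }
  assert (Hsq : Cmod (z0 + t) ^ 2 + Cmod (z0 + Ci * t) ^ 2 + Cmod (z0 + - t) ^ 2
                + Cmod (z0 + - (Ci * t)) ^ 2 = 4 * Cmod z0 ^ 2 + 4 * t ^ 2).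
  { destruct z0 as [x y]; unfold Cplus, Cmult, Copp, Ci, RtoC; simpl fst; simpl snd.
    rewrite !Cmod_sqr; ring. }
  clear F1 F2 F3 F4 Hpt.
  set (f1 := f (z0 + t)%C) in *; set (f2 := f (z0 + Ci * t)%C) in *.
  set (f4 := f (z0 + - t)%C) in *; set (f5 := f (z0 + - (Ci * t))%C) in *.
  pose proof (Cmod_triangle (f1 + f2 + f4) f5) as T1.
  pose proof (Cmod_triangle (f1 + f2) f4) as T2.
  pose proof (Cmod_triangle f1 f2) as T3.
  pose proof (Cmod_triangle (r1 + r2 + r3) r4) as S1.
  pose proof (Cmod_triangle (r1 + r2) r3) as S2.
  pose proof (Cmod_triangle r1 r2) as S3.
  pose proof (Cmod_triangle_inv (4 * c 0%nat) (r1 + r2 + r3 + r4)) as T0.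
  rewrite Hsum in T1; rewrite Cmod_mult, Cmod_R, Rabs_pos_eq in T0 by lra.
  fold a in T0.
  pose proof (Cmod_ge_0 f1); pose proof (Cmod_ge_0 f2).
  pose proof (Cmod_ge_0 f4); pose proof (Cmod_ge_0 f5).
  set (x1 := Cmod f1) in *; set (x2 := Cmod f2) in *.
  set (x3 := Cmod f4) in *; set (x4 := Cmod f5) in *.
  assert (Hlow : 4 * (a - t ^ 3 * N) <= x1 + x2 + x3 + x4) by lra.
  assert (Hup : x1 ^ 2 + x2 ^ 2 + x3 ^ 2 + x4 ^ 2 <= 4 * a ^ 2 - 4 * (eps * t ^ 2)) by nra.
  assert (Hcs : (x1 + x2 + x3 + x4) ^ 2 <= 4 * (x1 ^ 2 + x2 ^ 2 + x3 ^ 2 + x4 ^ 2)).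
  { pose proof (pow2_ge_0 (x1 - x2)); pose proof (pow2_ge_0 (x1 - x3)).
    pose proof (pow2_ge_0 (x1 - x4)); pose proof (pow2_ge_0 (x2 - x3)).
    pose proof (pow2_ge_0 (x2 - x4)); pose proof (pow2_ge_0 (x3 - x4)); nra. }
  assert (Ht2 : 0 < t ^ 2) by (apply pow_lt; exact Ht).
  assert (Hkey : 2 * a * (t ^ 3 * N) < eps * t ^ 2).
  { replace (2 * a * (t ^ 3 * N)) with (t * (2 * a * N) * t ^ 2) by ring.
    apply Rmult_lt_compat_r; [exact Ht2 | nra]. }
  assert (HtN : 0 < t ^ 3 * N).
  { apply Rmult_lt_0_compat; [apply pow_lt; exact Ht | exact HN]. }
  set (b := t ^ 3 * N) in *; set (S := x1 + x2 + x3 + x4) in *.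
  assert (HS : 0 <= S) by (unfold S; lra).
  destruct (Rle_lt_dec b a) as [Hab | Hab].
  - assert ((4 * (a - b)) ^ 2 <= S ^ 2) by (apply pow_incr; lra); nra.
  - nra.
Qed.

(** The term [eps |z|^2] forces the maximum of [|f|^2 + eps |z|^2] to the
    boundary even where [f] is constant; then [eps] tends to [0]. *)
Theorem maximum_principle (f : C -> C) (rho M : R) :
  0 <= rho -> 0 <= M ->
  (forall z, Cmod z <= rho -> taylor f z) ->
  (forall z, Cmod z = rho -> Cmod (f z) <= M) ->
  forall z, Cmod z <= rho -> Cmod (f z) <= M.
Proof.
  intros Hrho HM Hf Hbd z Hz.
  assert (Heps : forall eps, 0 < eps -> Cmod (f z) ^ 2 <= M ^ 2 + eps * rho ^ 2).
  { intros eps Heps.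
    destruct (closed_disc_max (fun z => Cmod (f z) ^ 2 + eps * Cmod z ^ 2) rho Hrho)
      as [z0 [Hz0 Hmax]].
    - intros y Hy eta Heta.
      assert (Hsq : forall a b d, 0 <= b -> 0 <= a -> Rabs (a - b) <= d -> d <= 1 ->
                Rabs (a ^ 2 - b ^ 2) <= d * (2 * b + 1)).
      { intros a b d Hb Ha Hab Hd1.
        replace (a ^ 2 - b ^ 2) with ((a - b) * (a + b)) by ring.
        rewrite Rabs_mult, (Rabs_pos_eq (a + b)) by lra.
        apply Rabs_le_between in Hab as Hab'.
        pose proof (Rabs_pos (a - b)); apply Rmult_le_compat; lra. }
      destruct (taylor_lipschitz f y (Hf y Hy)) as [L [HL HLip]].
      set (A := L * (2 * Cmod (f y) + 1) + eps * (2 * Cmod y + 1)).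
      assert (HA : 0 < A).
      { unfold A; pose proof (Cmod_ge_0 (f y)); pose proof (Cmod_ge_0 y); nra. }
      assert (Hsmall : near0 (fun w => L * Cmod w <= 1 /\ Cmod w <= 1 /\ A * Cmod w < eta)).
      { assert (H1 : 0 < / L) by now apply Rinv_0_lt_compat.
        assert (H2 : 0 < eta / A) by now apply Rdiv_lt_0_compat.
        exists (Rmin (Rmin (/ L) 1) (eta / A)); split.
        - repeat apply Rmin_glb_lt; lra.
        - intros w Hw.
          pose proof (Rmin_l (Rmin (/ L) 1) (eta / A)).
          pose proof (Rmin_r (Rmin (/ L) 1) (eta / A)).
          pose proof (Rmin_l (/ L) 1); pose proof (Rmin_r (/ L) 1).
          assert (L * Cmod w <= L * / L) by (apply Rmult_le_compat_l; lra).
          rewrite Rinv_r in H5 by lra.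
          assert (A * Cmod w < A * (eta / A)) by (apply Rmult_lt_compat_l; lra).
          replace (A * (eta / A)) with eta in H6 by (field; lra).
          repeat split; lra. }
      refine (near0_imp _ _ _ (near0_and _ _ HLip Hsmall)).
      intros w [B1 [B2 [B3 B4]]].
      assert (Hrev : forall p q, Rabs (Cmod p - Cmod q) <= Cmod (p - q)).
      { intros p q; apply Rabs_le; split.
        - pose proof (Cmod_triangle_inv q (p - q)) as T.
          replace (q + (p - q))%C with p in T by ring; lra.
        - pose proof (Cmod_triangle q (p - q)) as T.
          replace (q + (p - q))%C with p in T by ring; lra. }
      pose proof (Hsq (Cmod (f (y + w)%C)) (Cmod (f y)) (L * Cmod w)
        (Cmod_ge_0 _) (Cmod_ge_0 _)
        (Rle_trans _ _ _ (Hrev _ _) B1) B2) as D1.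
      assert (B5 : Rabs (Cmod (y + w) - Cmod y) <= Cmod w).
      { eapply Rle_trans; [apply Hrev|].
        replace (y + w - y)%C with w by ring; lra. }
      pose proof (Hsq (Cmod (y + w)%C) (Cmod y) (Cmod w)
        (Cmod_ge_0 _) (Cmod_ge_0 _) B5 B3) as D2.
      apply Rabs_le_between in D1; apply Rabs_le_between in D2.
      apply Rabs_def1; unfold A in B4; nra.
    - specialize (Hmax z Hz) as Hz1; simpl in Hz1.
      assert (Hzz : 0 <= Cmod z ^ 2) by apply pow2_ge_0.
      destruct (Rle_lt_or_eq_dec _ _ Hz0) as [Hlt | Heq].
      + exfalso; apply (no_interior_max f z0 eps (rho - Cmod z0)); [apply Hf; lra | lra | lra |].
        intros y Hy; apply Hmax.
        pose proof (Cmod_triangle z0 (y - z0)) as T.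
        replace (z0 + (y - z0))%C with y in T by ring; lra.
      + specialize (Hbd z0 Heq).
        assert (Cmod (f z0) ^ 2 <= M ^ 2).
        { apply pow_incr; split; [apply Cmod_ge_0 | exact Hbd]. }
        rewrite Heq in Hz1; nra. }
  apply Rnot_lt_le; intros Hlt.
  assert (HMf : M ^ 2 < Cmod (f z) ^ 2) by nra.
  pose proof (pow2_ge_0 rho) as Hr2.
  specialize (Heps ((Cmod (f z) ^ 2 - M ^ 2) / (2 * (rho ^ 2 + 1)))).
  assert (0 < (Cmod (f z) ^ 2 - M ^ 2) / (2 * (rho ^ 2 + 1)))
    by (apply Rdiv_lt_0_compat; lra).
  specialize (Heps H).
  assert ((Cmod (f z) ^ 2 - M ^ 2) / (2 * (rho ^ 2 + 1)) * (rho ^ 2 + 1)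
          = (Cmod (f z) ^ 2 - M ^ 2) / 2) by (field; lra).
  nra.
Qed.

(** * Schwarz lemma and coefficients of bounded functions *)

Lemma bernoulli_below (n : nat) (d : R) :
  0 <= d <= 1 -> 1 - INR n * d <= (1 - d) ^ n.
Proof.
  intros Hd; induction n as [|n IH]; [simpl; lra|].
  rewrite S_INR; simpl.
  assert (0 <= (1 - d) ^ n) by (apply pow_le; lra).
  pose proof (pos_INR n); nra.
Qed.

Lemma le_of_all_radii (n : nat) (a B r : R) :
  0 <= a -> r < 1 ->
  (forall rho, 0 < rho -> r <= rho -> rho < 1 -> rho ^ n * a <= B) -> a <= B.
Proof.
  intros Ha Hr H; apply Rnot_lt_le; intros Hlt.
  pose proof (pos_INR n) as Hn.
  assert (Hden : 0 < 2 * (INR n * a + 1)) by nra.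
  pose (d := Rmin (Rmin (1 - r) 1 / 2) ((a - B) / (2 * (INR n * a + 1)))).
  assert (Hd0 : 0 < d).
  { apply Rmin_glb_lt.
    - pose proof (Rmin_glb_lt (1 - r) 1 0); lra.
    - apply Rdiv_lt_0_compat; lra. }
  assert (Hd1 : d <= Rmin (1 - r) 1 / 2) by apply Rmin_l.
  pose proof (Rmin_l (1 - r) 1); pose proof (Rmin_r (1 - r) 1).
  assert (Hd2 : d * (INR n * a + 1) <= (a - B) / 2).
  { assert (E : d <= (a - B) / (2 * (INR n * a + 1))) by apply Rmin_r.
    apply Rmult_le_compat_r with (r := INR n * a + 1) in E; [|lra].
    replace ((a - B) / (2 * (INR n * a + 1)) * (INR n * a + 1)) with ((a - B) / 2) in E
      by (field; lra); exact E. }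
  specialize (H (1 - d)).
  assert (H' : (1 - d) ^ n * a <= B) by (apply H; lra).
  pose proof (bernoulli_below n d); nra.
Qed.

(** On [|z| = rho] the quotient is at most [B / rho ^ n], hence also inside by the
    maximum principle, and [rho] may tend to [1]. *)
Theorem schwarz_quotient (F : C -> C) (n : nat) (c : nat -> C) (B : R) :
  0 <= B ->
  (forall z, Cmod z < 1 -> taylor F z) ->
  (forall z, Cmod z < 1 -> Cmod (F z) <= B) ->
  jet (S n) c F -> (forall i, (i < n)%nat -> c i = RtoC 0) ->
  exists psi : C -> C,
    (forall z, Cmod z < 1 -> F z = (z ^ n * psi z)%C) /\
    (forall z, Cmod z < 1 -> taylor psi z) /\
    (forall z, Cmod z < 1 -> Cmod (psi z) <= B) /\
    psi (RtoC 0) = c n.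
Proof.
  intros HB HF Hbd Hj Hc.
  assert (Hex : exists psi : C -> C, psi (RtoC 0) = c n /\
            forall z, z <> RtoC 0 -> psi z = (F z * / z ^ n)%C).
  { exists (fun z => if excluded_middle_informative (z = RtoC 0)
                     then c n else (F z * / z ^ n)%C); split.
    - destruct excluded_middle_informative; [reflexivity | congruence].
    - intros z Hz; destruct excluded_middle_informative; [congruence | reflexivity]. }
  destruct Hex as [psi [Hpsi0 Hpsi]].
  assert (H1 : forall z, Cmod z < 1 -> F z = (z ^ n * psi z)%C).
  { intros z Hz; destruct (classic (z = RtoC 0)) as [-> | Hz0].
    - rewrite Hpsi0, (jet_at0 _ _ _ Hj).
      destruct n as [|n]; [simpl; ring|].
      rewrite Hc by lia; simpl; ring.
    - rewrite (Hpsi z Hz0); field; now apply Cpow_nz. }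
  assert (H2 : forall z, Cmod z < 1 -> taylor psi z).
  { intros z Hz; destruct (classic (z = RtoC 0)) as [-> | Hz0].
    - intros N; destruct (HF (RtoC 0) Hz (n + S N)%nat) as [d Hd].
      assert (Hd' : jet (n + S N) d F).
      { refine (jet_ext _ _ _ _ _ (fun _ _ => eq_refl) _ Hd).
        apply near0_all; intros w; f_equal; ring. }
      assert (Hcd : forall i, (i < S n)%nat -> c i = d i).
      { apply (jet_unique (S n) c d F F Hj).
        - apply (jet_le (S n) (n + S N)); [lia | exact Hd'].
        - apply near0_all; auto. }
      destruct (jet_remainder n (S N) d F) as [f1 [Hf1 Hj1]].
      { intros i Hi; rewrite <- Hcd by lia; apply Hc, Hi. }
      { exact Hd'. }
      exists (fun i => d (n + i)%nat).
      refine (jet_ext _ _ _ _ _ (fun _ _ => eq_refl) _ (jet_weaken _ _ _ Hj1)).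
      revert Hf1; apply near0_imp; intros w E.
      replace (0 + w)%C with w by ring.
      destruct (classic (w = RtoC 0)) as [-> | Hw].
      + rewrite (jet_at0 _ _ _ Hj1), Hpsi0, Nat.add_0_r; symmetry; apply Hcd; lia.
      + rewrite (Hpsi w Hw), E; field; now apply Cpow_nz.
    - apply (taylor_ext (fun z => F z * / z ^ n)%C).
      + exists (Cmod z); split; [now apply Cmod_gt_0|].
        intros w Hw; symmetry; apply Hpsi; intros E.
        assert (Ew : w = (- z)%C) by (replace w with (z + w - z)%C by ring; rewrite E; ring).
        rewrite Ew, Cmod_opp in Hw; lra.
      + apply taylor_mult; [now apply HF|].
        apply (taylor_inv (fun z => z ^ n)%C); [apply taylor_pow | now apply Cpow_nz]. }
  exists psi; repeat split; try assumption.
  intros z Hz; apply (le_of_all_radii n _ B (Cmod z)); [apply Cmod_ge_0 | exact Hz |].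
  intros rho Hrho Hzr Hr1.
  assert (Hpow : 0 < rho ^ n) by now apply pow_lt.
  assert (Hmax : Cmod (psi z) <= B / rho ^ n).
  { apply (maximum_principle psi rho); [lra | | | | exact Hzr].
    - now apply Rcomplements.Rdiv_le_0_compat.
    - intros y Hy; apply H2; lra.
    - intros y Hy.
      assert (Hy1 : Cmod y < 1) by lra.
      specialize (Hbd y Hy1); rewrite (H1 y Hy1), Cmod_mult, Cmod_pow, Hy in Hbd.
      apply Rcomplements.Rle_div_r; [exact Hpow | lra]. }
  apply Rmult_le_compat_l with (r := rho ^ n) in Hmax; [|lra].
  replace (rho ^ n * (B / rho ^ n)) with B in Hmax by (field; lra); exact Hmax.
Qed.

Definition root_of_unity (n : nat) : C :=
  (cos (2 * PI / INR n), sin (2 * PI / INR n)).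

Lemma root_of_unity_pow (n i : nat) :
  (root_of_unity n ^ i)%C =
  (cos (INR i * (2 * PI / INR n)), sin (INR i * (2 * PI / INR n))).
Proof.
  induction i as [|i IH].
  - simpl Cpow; simpl INR; rewrite Rmult_0_l, cos_0, sin_0; reflexivity.
  - change (root_of_unity n ^ S i)%C with (root_of_unity n * root_of_unity n ^ i)%C.
    rewrite IH, S_INR.
    replace ((INR i + 1) * (2 * PI / INR n))
      with (2 * PI / INR n + INR i * (2 * PI / INR n)) by ring.
    rewrite cos_plus, sin_plus; unfold root_of_unity, Cmult; simpl.
    apply injective_projections; simpl; ring.
Qed.

Lemma Cmod_root_of_unity (n : nat) : Cmod (root_of_unity n) = 1.
Proof.
  unfold Cmod, root_of_unity; simpl fst; simpl snd.
  rewrite <- sqrt_1; f_equal.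
  pose proof (sin2_cos2 (2 * PI / INR n)) as H; unfold Rsqr in H; lra.
Qed.

Lemma root_of_unity_pow_order (n : nat) :
  (1 <= n)%nat -> (root_of_unity n ^ n)%C = RtoC 1.
Proof.
  intros Hn; rewrite root_of_unity_pow.
  assert (0 < INR n) by (apply lt_0_INR; lia).
  replace (INR n * (2 * PI / INR n)) with (2 * PI) by (field; lra).
  now rewrite cos_2PI, sin_2PI.
Qed.

Lemma root_of_unity_pow_neq1 (n i : nat) :
  (0 < i < n)%nat -> (root_of_unity n ^ i)%C <> RtoC 1.
Proof.
  intros Hi; rewrite root_of_unity_pow; intros E.
  apply (f_equal fst) in E; simpl in E.
  assert (Hn : 0 < INR n) by (apply lt_0_INR; lia).
  assert (Hi0 : 0 < INR i) by (apply lt_0_INR; lia).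
  assert (Hin : INR i < INR n) by (apply lt_INR; lia).
  pose proof PI_RGT_0 as HPI.
  set (x := INR i * PI / INR n).
  replace (INR i * (2 * PI / INR n)) with (2 * x) in E by (unfold x; field; lra).
  rewrite cos_2a_sin in E.
  assert (Hx : 0 < x < PI).
  { split; [unfold x; apply Rdiv_lt_0_compat; nra|].
    unfold x; apply Rcomplements.Rlt_div_l; nra. }
  pose proof (sin_gt_0 x (proj1 Hx) (proj2 Hx)); nra.
Qed.

Lemma geometric_sum (x : C) (m : nat) :
  (sum_n (G := C_AbelianGroup) (fun j => x ^ j) m * (x - 1) = x ^ S m - 1)%C.
Proof.
  induction m as [|m IH].
  - rewrite sum_O; simpl; ring.
  - rewrite sum_Sn; change plus with Cplus.
    rewrite Cmult_plus_distr_r, IH; simpl; ring.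
Qed.

Lemma Cmult_eq_0_l (s x : C) : x <> RtoC 0 -> (s * x)%C = RtoC 0 -> s = RtoC 0.
Proof.
  intros Hx H; transitivity (s * x * / x)%C; [field; exact Hx | rewrite H; ring].
Qed.

Lemma root_of_unity_sum (n i : nat) :
  (0 < i < n)%nat ->
  sum_n (G := C_AbelianGroup) (fun j => (root_of_unity n ^ i) ^ j)%C (pred n) = RtoC 0 :> C.
Proof.
  intros Hi.
  pose proof (geometric_sum (root_of_unity n ^ i) (pred n)) as H.
  replace (S (pred n)) with n in H by lia.
  rewrite <- Cpow_mult_r, Nat.mul_comm, Cpow_mult_r in H.
  rewrite root_of_unity_pow_order, Cpow_1_l in H by lia.
  replace (1 - 1)%C with (RtoC 0) in H by ring.
  apply root_of_unity_pow_neq1 in Hi as Hne.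
  refine (Cmult_eq_0_l _ _ _ (eq_trans H _)); [|ring].
  intros E; apply Hne.
  replace (root_of_unity n ^ i)%C with (root_of_unity n ^ i - 1 + 1)%C by ring.
  rewrite E; ring.
Qed.

Lemma jet_sum (N m : nat) (c : nat -> nat -> C) (f : nat -> C -> C) :
  (forall j, jet N (c j) (f j)) ->
  jet N (fun i => sum_n (G := C_AbelianGroup) (fun j => c j i) m)
        (fun w => sum_n (G := C_AbelianGroup) (fun j => f j w) m).
Proof.
  intros H; induction m as [|m IH].
  - refine (jet_ext _ _ _ _ _ _ _ (H 0%nat)).
    + intros i _; now rewrite sum_O.
    + apply near0_all; intros w; now rewrite sum_O.
  - refine (jet_ext _ _ _ _ _ _ _ (jet_plus _ _ _ _ _ IH (H (S m)))).
    + intros i _; now rewrite sum_Sn.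
    + apply near0_all; intros w; now rewrite sum_Sn.
Qed.

Lemma taylor_rotate (f : C -> C) (zeta z0 : C) :
  Cmod zeta = 1 -> taylor f (zeta * z0)%C -> taylor (fun z => f (zeta * z)%C) z0.
Proof.
  intros Hz Hf n; destruct (Hf n) as [c Hc].
  exists (fun i => (zeta ^ i * c i)%C).
  refine (jet_ext _ _ _ _ _ (fun _ _ => eq_refl) _ (jet_rotate n zeta Hz _ _ Hc)).
  apply near0_all; intros w; f_equal; ring.
Qed.

Lemma taylor_sum (f : nat -> C -> C) (m : nat) (z0 : C) :
  (forall j, taylor (f j) z0) ->
  taylor (fun z => sum_n (G := C_AbelianGroup) (fun j => f j z) m) z0.
Proof.
  intros H; induction m as [|m IH].
  - apply (taylor_ext (f 0%nat)); [|apply H].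
    apply near0_all; intros; now rewrite sum_O.
  - apply (taylor_ext (fun z => sum_n (G := C_AbelianGroup) (fun j => f j z) m + f (S m) z)%C).
    + apply near0_all; intros; now rewrite sum_Sn.
    + apply (taylor_plus _ (f (S m))); auto.
Qed.

Lemma Cmod_sum_le (a : nat -> C) (M : R) (m : nat) :
  (forall j, Cmod (a j) <= M) ->
  Cmod (sum_n (G := C_AbelianGroup) a m) <= INR (S m) * M.
Proof.
  intros H; induction m as [|m IH].
  - rewrite sum_O; simpl; specialize (H 0%nat); lra.
  - rewrite sum_Sn; change plus with Cplus.
    eapply Rle_trans; [apply Cmod_triangle|].
    rewrite S_INR; specialize (H (S m)); lra.
Qed.

Lemma sum_n_const_C (a : C) (m : nat) :
  sum_n (G := C_AbelianGroup) (fun _ => a) m = (RtoC (INR (S m)) * a)%C :> C.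
Proof.
  induction m as [|m IH].
  - rewrite sum_O; simpl; ring.
  - rewrite sum_Sn, IH, (S_INR (S m)), RtoC_plus; change plus with Cplus; ring.
Qed.

Lemma sum_n_scal_C (a : C) (u : nat -> C) (m : nat) :
  sum_n (G := C_AbelianGroup) (fun j => u j * a)%C m
  = (sum_n (G := C_AbelianGroup) u m * a)%C :> C.
Proof.
  induction m as [|m IH]; [now rewrite !sum_O|].
  rewrite !sum_Sn, IH; change plus with Cplus; ring.
Qed.

(** Averaging over the rotations by [n]-th roots of unity keeps exactly the
    coefficients whose index is a multiple of [n]. *)
Lemma rotation_average (F : C -> C) (n : nat) (c : nat -> C) (M : R) :
  (1 <= n)%nat ->
  (forall z, Cmod z < 1 -> taylor F z) ->
  (forall z, Cmod z < 1 -> Cmod (F z) <= M) ->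
  jet (S n) c F ->
  exists (G : C -> C) (d : nat -> C),
    (forall z, Cmod z < 1 -> taylor G z) /\
    (forall z, Cmod z < 1 -> Cmod (G z) <= M) /\
    jet (S n) d G /\ d 0%nat = c 0%nat /\ d n = c n /\
    forall i, (0 < i < n)%nat -> d i = RtoC 0.
Proof.
  intros Hn HF HM Hj.
  assert (Hn0 : 0 < INR n) by (apply lt_0_INR; lia).
  assert (HnC : RtoC (INR n) <> RtoC 0) by (intros E; apply RtoC_inj in E; lra).
  set (zeta := root_of_unity n).
  assert (Hz : forall j, Cmod (zeta ^ j)%C = 1).
  { intros j; unfold zeta; rewrite Cmod_pow, Cmod_root_of_unity; apply pow1. }
  exists (fun z => / INR n * sum_n (G := C_AbelianGroup) (fun j => F (zeta ^ j * z)) (pred n))%C.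
  exists (fun i => / INR n * sum_n (G := C_AbelianGroup) (fun j => (zeta ^ j) ^ i * c i) (pred n))%C.
  assert (Hswap : forall i j, ((zeta ^ j) ^ i = (zeta ^ i) ^ j)%C).
  { intros i j; rewrite <- !Cpow_mult_r; f_equal; lia. }
  assert (Hone : forall i, (forall j, (zeta ^ i) ^ j = 1)%C ->
    (/ INR n * sum_n (G := C_AbelianGroup) (fun j => (zeta ^ j) ^ i * c i) (pred n) = c i)%C).
  { intros i Hi.
    rewrite (sum_n_ext _ (fun _ => c i)).
    - rewrite sum_n_const_C; replace (S (pred n)) with n by lia; field; exact HnC.
    - intros j; rewrite Hswap, Hi; exact (Cmult_1_l _). }
  repeat split.
  - intros z Hz1; apply (taylor_mult (fun _ => / INR n)%C); [apply taylor_const|].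
    apply (taylor_sum (fun j z => F (zeta ^ j * z)%C)); intros j.
    apply taylor_rotate; [apply Hz|]; apply HF; rewrite Cmod_mult, Hz; lra.
  - intros z Hz1; rewrite Cmod_mult, Cmod_inv, Cmod_R, Rabs_pos_eq by (trivial; lra).
    assert (Hs : Cmod (sum_n (G := C_AbelianGroup) (fun j => F (zeta ^ j * z)%C) (pred n))
                 <= INR n * M).
    { replace (INR n) with (INR (S (pred n))) by (f_equal; lia).
      apply Cmod_sum_le; intros j; apply HM; rewrite Cmod_mult, Hz; lra. }
    apply Rmult_le_compat_l with (r := / INR n) in Hs.
    + replace (/ INR n * (INR n * M)) with M in Hs by (field; lra); exact Hs.
    + apply Rlt_le, Rinv_0_lt_compat, Hn0.
  - apply (jet_scal (S n) (/ INR n)%C).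
    apply (jet_sum (S n) (pred n) (fun j i => (zeta ^ j) ^ i * c i)%C
             (fun j w => F (zeta ^ j * w)%C)); intros j.
    now apply jet_rotate.
  - apply Hone; intros j; simpl; apply Cpow_1_l.
  - apply Hone; intros j; unfold zeta.
    rewrite root_of_unity_pow_order by exact Hn; apply Cpow_1_l.
  - intros i Hi.
    rewrite (sum_n_ext _ (fun j => (zeta ^ i) ^ j * c i)%C).
    + rewrite sum_n_scal_C; unfold zeta; rewrite root_of_unity_sum by exact Hi; ring.
    + intros j; rewrite Hswap; reflexivity.
Qed.

Lemma conv_leading (d : nat -> C) (n : nat) : forall (c : nat -> C),
  (forall i, (i < n)%nat -> c i = RtoC 0) ->
  (forall i, (i < n)%nat -> conv c d i = RtoC 0) /\
  conv c d n = (c n * d 0%nat)%C.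
Proof.
  induction n as [|n IH]; intros c Hc.
  - split; [intros; lia | reflexivity].
  - destruct (IH (fun i => c (S i))) as [H1 H2].
    { intros i Hi; apply Hc; lia. }
    split; [intros [|i] Hi|].
    + simpl; rewrite Hc by lia; ring.
    + simpl; rewrite H1, Hc by lia; ring.
    + simpl; rewrite H2, Hc by lia; ring.
Qed.

(** After averaging over rotations only [c_0] and [c_n] matter up to order [n].
    The Moebius transform taking [c_0] to [0] then has a zero of order [n] with
    leading coefficient [B c_n / (B^2 - |c_0|^2)], which the Schwarz lemma bounds
    by [1]. The strict inequality [M < B] keeps the transform regular even if
    [|c_0| = M]. *)
Theorem bounded_coef (F : C -> C) (n : nat) (c : nat -> C) (M B : R) :
  (1 <= n)%nat -> M < B ->
  (forall z, Cmod z < 1 -> taylor F z) ->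
  (forall z, Cmod z < 1 -> Cmod (F z) <= M) ->
  jet (S n) c F ->
  B * Cmod (c n) <= B ^ 2 - Cmod (c 0%nat) ^ 2.
Proof.
  intros Hn HMB HF HM Hj.
  destruct (rotation_average F n c M Hn HF HM Hj)
    as [G [d [HG [HGM [Hjd [Hd0 [Hdn Hdi]]]]]]].
  assert (H01 : Cmod (RtoC 0) < 1) by (rewrite Cmod_0; lra).
  rewrite <- Hd0, <- Hdn; clear c F HF HM Hj Hd0 Hdn.
  set (a := d 0%nat).
  assert (HG0 : G (RtoC 0) = a) by exact (jet_at0 _ _ _ Hjd).
  assert (Ha : Cmod a <= M) by (rewrite <- HG0; apply HGM, H01).
  pose proof (Cmod_ge_0 a) as Ha0.
  set (den := fun z => (RtoC (B ^ 2) + - Cconj a * G z)%C).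
  assert (Hden : forall z, Cmod z < 1 -> den z <> RtoC 0).
  { intros z Hz; apply Cmod_gt_0; unfold den.
    pose proof (Cmod_triangle_inv (RtoC (B ^ 2)) (- Cconj a * G z)) as T.
    rewrite Cmod_mult, Cmod_opp, Cmod_conj, Cmod_R, Rabs_pos_eq in T
      by apply pow2_ge_0.
    specialize (HGM z Hz); pose proof (Cmod_ge_0 (G z)); nra. }
  set (E := fun z => (RtoC B * / den z)%C).
  assert (HE : forall z, Cmod z < 1 -> taylor E z).
  { intros z Hz; apply (taylor_mult (fun _ => RtoC B)); [apply taylor_const|].
    apply taylor_inv; [|now apply Hden].
    apply (taylor_plus (fun _ => RtoC (B ^ 2))); [apply taylor_const|].
    apply (taylor_mult (fun _ => (- Cconj a)%C)); [apply taylor_const | now apply HG]. }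
  destruct (HE (RtoC 0) H01 (S n)) as [e He].
  assert (He' : jet (S n) e E).
  { refine (jet_ext _ _ _ _ _ (fun _ _ => eq_refl) _ He).
    apply near0_all; intros w; f_equal; ring. }
  pose proof (jet_at0 _ _ _ He') as He0.
  pose proof (jet_plus _ _ _ _ _ Hjd (jet_const (S n) (- a)%C)) as Hjd'.
  set (q := fun i => (d i + const_coef (- a) i)%C) in Hjd'.
  pose proof (jet_mult _ _ _ _ _ Hjd' He') as HW.
  assert (Hq : forall i, (i < n)%nat -> q i = RtoC 0).
  { intros [|i] Hi; unfold q; simpl; fold a; [ring|].
    rewrite Hdi by lia; ring. }
  destruct (conv_leading e n q Hq) as [Hlow Hlead].
  destruct (schwarz_quotient (fun w => (G w + - a) * E w)%C n (conv q e) 1)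
    as [psi [_ [_ [Hpsi Hpsi0]]]]; try assumption.
  - lra.
  - intros z Hz; apply (taylor_mult (fun z => G z + - a)%C); [|now apply HE].
    apply (taylor_plus G); [now apply HG | apply taylor_const].
  - intros z Hz; unfold E; specialize (Hden z Hz); specialize (HGM z Hz).
    apply Cmod_gt_0 in Hden as Hpos.
    rewrite !Cmod_mult, Cmod_inv, Cmod_R, Rabs_pos_eq by (trivial; lra).
    assert (Hkey : Cmod (G z + - a) * B <= Cmod (den z)).
    { apply Rsqr_incr_0_var; [|lra].
      assert (Cmod (G z) ^ 2 <= B ^ 2).
      { apply pow_incr; split; [apply Cmod_ge_0 | lra]. }
      assert (Cmod a ^ 2 <= B ^ 2) by (apply pow_incr; lra).
      unfold Rsqr; rewrite <- !Rsqr_def, !Rsqr_pow2, Rpow_mult_distr.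
      revert H H0; unfold den; destruct (G z) as [x y]; destruct a as [u v].
      unfold Cplus, Cmult, Copp, Cconj, RtoC; simpl fst; simpl snd.
      rewrite !Cmod_sqr; intros HA HBB.
      enough (0 <= (B ^ 2 - (x ^ 2 + y ^ 2)) * (B ^ 2 - (u ^ 2 + v ^ 2))) by nra.
      apply Rmult_le_pos; lra. }
    replace (Cmod (G z + - a) * (B * / Cmod (den z)))
      with (Cmod (G z + - a) * B / Cmod (den z)) by (field; lra).
    apply Rcomplements.Rle_div_l; lra.
  - specialize (Hpsi (RtoC 0) H01); rewrite Hpsi0, Hlead in Hpsi.
    assert (Hqn : q n = d n).
    { unfold q; destruct n as [|m]; [lia|]; simpl; ring. }
    rewrite Hqn, Cmod_mult, <- He0 in Hpsi; unfold E, den in Hpsi; rewrite HG0 in Hpsi.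
    assert (Hreal : (RtoC (B ^ 2) + - Cconj a * a)%C = RtoC (B ^ 2 - Cmod a ^ 2)).
    { replace (- Cconj a * a)%C with (- (a * Cconj a))%C by ring.
      rewrite <- Cmod2_conj, RtoC_minus, !RtoC_pow; reflexivity. }
    rewrite Hreal in Hpsi.
    assert (Hpos : 0 < B ^ 2 - Cmod a ^ 2) by nra.
    rewrite Cmod_mult, Cmod_inv, !Cmod_R, !Rabs_pos_eq in Hpsi; try lra.
    + apply Rmult_le_compat_r with (r := B ^ 2 - Cmod a ^ 2) in Hpsi; [|lra].
      replace (Cmod (d n) * (B * / (B ^ 2 - Cmod a ^ 2)) * (B ^ 2 - Cmod a ^ 2))
        with (B * Cmod (d n)) in Hpsi by (field; lra).
      lra.
    + intros EE; apply RtoC_inj in EE; lra.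
Qed.

(** * Complex power series *)

Lemma Cminus_0_r (x : C) : (x - 0)%C = x.
Proof. ring. Qed.

Lemma is_series_dist (a : nat -> C) (l x : C) (S : R) :
  is_series (K := C_AbsRing) (V := C_NormedModule) a l ->
  (forall n, Cmod (sum_n (G := C_AbelianGroup) a n - x)%C <= S) -> Cmod (l - x)%C <= S.
Proof.
  intros Hl HS; apply le_epsilon; intros eps Heps.
  destruct (proj1 (filterlim_locally_ball_norm (K := C_AbsRing) (U := C_NormedModule) _ _)
              Hl (mkposreal eps Heps)) as [N HN].
  specialize (HN N (Nat.le_refl N)); specialize (HS N).
  unfold ball_norm in HN; change norm with Cmod in HN.
  change (Cmod (sum_n (G := C_AbelianGroup) a N - l)%C < eps) in HN.
  pose proof (Cmod_triangle (l - sum_n (G := C_AbelianGroup) a N)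
                (sum_n (G := C_AbelianGroup) a N - x)) as T.
  replace (l - sum_n (G := C_AbelianGroup) a N + (sum_n (G := C_AbelianGroup) a N - x))%C
    with (l - x)%C in T by ring.
  rewrite Cmod_minus_sym in HN; lra.
Qed.

Lemma is_series_C_ext (a b : nat -> C) (l : C) :
  (forall n, a n = b n) ->
  is_series (K := C_AbsRing) (V := C_NormedModule) a l ->
  is_series (K := C_AbsRing) (V := C_NormedModule) b l.
Proof. intros H; apply is_series_ext; exact H. Qed.

Lemma power_series_tail (c : nat -> C) (w l : C) :
  w <> RtoC 0 -> is_power_series_from 0 c w l ->
  is_power_series_from 0 (fun i => c (S i)) w ((l - c 0%nat) / w)%C.
Proof.
  intros Hw H; unfold is_power_series_from in *; simpl in *.
  pose (b := fun n => (c n * w ^ n)%C).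
  assert (H1 : is_series (K := C_AbsRing) (V := C_NormedModule) (fun n => b (S n))
                 (l - c 0%nat)%C).
  { apply is_series_incr_1.
    change (is_series (K := C_AbsRing) (V := C_NormedModule) b
              (l - c 0%nat + b 0%nat)%C).
    replace (l - c 0%nat + b 0%nat)%C with l by (unfold b; simpl; ring).
    exact H. }
  apply (is_series_scal (K := C_AbsRing) (V := C_NormedModule) (/ w)%C) in H1.
  replace ((l - c 0%nat) / w)%C with (/ w * (l - c 0%nat))%C by (field; exact Hw).
  revert H1; apply is_series_C_ext; intros n; unfold b; change scal with Cmult.
  simpl; field; exact Hw.
Qed.

Lemma power_series_at0 (c : nat -> C) (l : C) :
  is_power_series_from 0 c (RtoC 0) l -> l = c 0%nat.
Proof.
  intros H; unfold is_power_series_from in H; simpl in H.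
  assert (E : Cmod (l - c 0%nat) <= 0).
  { apply (is_series_dist _ _ _ _ H); intros n.
    assert (Hs : sum_n (G := C_AbelianGroup) (fun n => c n * 0 ^ n)%C n = c 0%nat :> C).
    { induction n as [|n IH].
      - rewrite sum_O; simpl; apply Cmult_1_r.
      - rewrite sum_Sn, IH; change plus with Cplus; simpl; ring. }
    rewrite Hs; replace (c 0%nat - c 0%nat)%C with (RtoC 0) by ring.
    rewrite Cmod_0; lra. }
  assert (E0 : (l - c 0%nat)%C = RtoC 0).
  { apply Cmod_eq_0; pose proof (Cmod_ge_0 (l - c 0%nat)); lra. }
  replace l with (l - c 0%nat + c 0%nat)%C by ring; rewrite E0; ring.
Qed.

Lemma power_series_coef_bound (c : nat -> C) (rho : R) (l : C) :
  0 < rho -> is_power_series_from 0 c (RtoC rho) l ->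
  exists A : R, 0 < A /\ forall n, Cmod (c n) * rho ^ n <= A.
Proof.
  intros Hrho H; unfold is_power_series_from in H; simpl in H.
  destruct (filterlim_bounded (K := C_AbsRing) (V := C_NormedModule)
              (sum_n (fun n => c n * rho ^ n)%C)) as [M HM]; [now exists l|].
  change norm with Cmod in HM.
  assert (Hn : forall n, Cmod (c n) * rho ^ n = Cmod (c n * rho ^ n)%C).
  { intros n; rewrite Cmod_mult, Cmod_pow, Cmod_R, Rabs_pos_eq; [reflexivity | lra]. }
  assert (HM0 : 0 <= M) by (eapply Rle_trans; [apply Cmod_ge_0 | apply (HM 0%nat)]).
  exists (2 * M + 1); split; [lra|]; intros [|n]; rewrite Hn.
  - specialize (HM 0%nat); rewrite sum_O in HM; lra.
  - pose proof (HM (S n)) as H1; rewrite sum_Sn in H1; change plus with Cplus in H1.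
    specialize (HM n).
    set (s := sum_n _ n) in *.
    pose proof (Cmod_triangle_inv (c (S n) * rho ^ S n)%C s) as T.
    rewrite Cplus_comm in T; lra.
Qed.

Lemma geometric_partial_bound (u : nat -> C) (A q : R) (n : nat) :
  0 <= q < 1 -> (forall i, Cmod (u i) <= A * q ^ i) ->
  Cmod (sum_n (G := C_AbelianGroup) u n) <= A / (1 - q).
Proof.
  intros Hq Hu.
  assert (HA : 0 <= A).
  { specialize (Hu 0%nat); pose proof (Cmod_ge_0 (u 0%nat)); simpl in Hu; lra. }
  enough (Cmod (sum_n (G := C_AbelianGroup) u n) <= A * (1 - q ^ S n) / (1 - q)).
  { assert (0 <= q ^ S n) by (apply pow_le; lra).
    eapply Rle_trans; [exact H|].
    apply Rmult_le_compat_r; [apply Rlt_le, Rinv_0_lt_compat; lra | nra]. }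
  induction n as [|n IH].
  - rewrite sum_O; specialize (Hu 0%nat); simpl in *.
    replace (A * (1 - q * 1) / (1 - q)) with A by (field; lra); lra.
  - rewrite sum_Sn; change plus with Cplus.
    eapply Rle_trans; [apply Cmod_triangle|].
    specialize (Hu (S n)).
    replace (A * (1 - q ^ S (S n)) / (1 - q))
      with (A * (1 - q ^ S n) / (1 - q) + A * q ^ S n) by (simpl; field; lra).
    lra.
Qed.

Lemma jet_power_series (n : nat) : forall (c : nat -> C) (F : C -> C) (e : R),
  0 < e -> (forall w, Cmod w < e -> is_power_series_from 0 c w (F w)) -> jet n c F.
Proof.
  induction n as [|n IH]; intros c F e He HF.
  - assert (He2 : 0 < e / 2) by lra.
    destruct (power_series_coef_bound c (e / 2) (F (RtoC (e / 2))) He2) as [A [HA Hc]].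
    { apply HF; rewrite Cmod_R, Rabs_pos_eq; lra. }
    exists (A / (1 - / 2)), (e / 4); split; [lra|]; intros w Hw.
    assert (Hwe : Cmod w < e) by lra.
    replace (F w) with (F w - 0)%C by ring.
    apply (is_series_dist _ _ _ _ (HF w Hwe)); intros m.
    rewrite Cminus_0_r.
    apply geometric_partial_bound; [lra|]; intros i; simpl.
    rewrite Cmod_mult, Cmod_pow.
    apply Rle_trans with (Cmod (c i) * (e / 2 * / 2) ^ i).
    + apply Rmult_le_compat_l; [apply Cmod_ge_0|].
      apply pow_incr; split; [apply Cmod_ge_0 | lra].
    + rewrite Rpow_mult_distr, <- Rmult_assoc.
      apply Rmult_le_compat_r; [apply pow_le; lra | apply Hc].
  - exists (fun w => if excluded_middle_informative (w = RtoC 0) then c 1%nat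
                     else ((F w - c 0%nat) / w)%C); split.
    + exists e; split; [exact He|]; intros w Hw.
      destruct excluded_middle_informative as [-> | Hw0].
      * rewrite (power_series_at0 c (F (RtoC 0))) by (apply HF; exact Hw); ring.
      * field; exact Hw0.
    + apply (IH _ _ e He); intros w Hw.
      destruct excluded_middle_informative as [-> | Hw0].
      * unfold is_power_series_from; simpl.
        apply (is_series_decr_1 (K := C_AbsRing) (V := C_NormedModule)).
        change plus with Cplus; change opp with Copp; simpl.
        replace (c 1%nat + - (c 1%nat * 1))%C with (RtoC 0) by ring.
        apply (filterlim_ext (fun _ => RtoC 0)); [|apply filterlim_const].
        intros m; induction m as [|m IHm].
        -- rewrite sum_O; change (@eq C (RtoC 0) (c 2%nat * (0 * 1))%C); ring.
        -- rewrite sum_Sn, <- IHm; change plus with Cplus; simpl; ring.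
      * apply power_series_tail; auto.
Qed.

(** * Termwise differentiation *)

Definition dpow (i : nat) (w : C) : C :=
  match i with O => RtoC 0 | S j => (INR (S j) * w ^ j)%C end.

(** The identity
    [(w + v)^(i+1) - w^(i+1) - (i+1) w^i v = (w + v) E_i + i w^(i-1) v^2],
    where [E_i] is the same expression for [i], gives the quadratic bound. *)
Lemma dpow_error (w v : C) (s : R) (i : nat) :
  0 <= s -> Cmod w <= s -> Cmod (w + v) <= s ->
  s ^ 2 * Cmod ((w + v) ^ i - w ^ i - dpow i w * v)%C
  <= INR i ^ 2 * s ^ i * Cmod v ^ 2.
Proof.
  intros Hs Hw Hwv; induction i as [|i IH].
  - simpl; replace (1 - 1 - 0 * v)%C with (RtoC 0) by ring; rewrite Cmod_0; lra.
  - set (E := ((w + v) ^ i - w ^ i - dpow i w * v)%C) in *.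
    replace ((w + v) ^ S i - w ^ S i - dpow (S i) w * v)%C
      with ((w + v) * E + dpow i w * (v * v))%C.
    2:{ unfold E; destruct i as [|i]; [simpl; ring|].
        unfold dpow; rewrite (S_INR (S i)), RtoC_plus; simpl Cpow; ring. }
    assert (Hd : s ^ 2 * Cmod (dpow i w) <= INR i * s ^ S i).
    { destruct i as [|i]; [simpl; rewrite Cmod_0; lra|].
      unfold dpow; rewrite Cmod_mult, Cmod_R, Cmod_pow, Rabs_pos_eq by apply pos_INR.
      replace (INR (S i) * s ^ S (S i)) with (s ^ 2 * (INR (S i) * s ^ i)) by (simpl; ring).
      apply Rmult_le_compat_l; [apply pow2_ge_0|].
      apply Rmult_le_compat_l; [apply pos_INR|].
      apply pow_incr; split; [apply Cmod_ge_0 | exact Hw]. }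
    assert (T : Cmod ((w + v) * E + dpow i w * (v * v))
                <= s * Cmod E + Cmod (dpow i w) * Cmod v ^ 2).
    { eapply Rle_trans; [apply Cmod_triangle|].
      rewrite !Cmod_mult.
      assert (Cmod (w + v) * Cmod E <= s * Cmod E)
        by (apply Rmult_le_compat_r; [apply Cmod_ge_0 | exact Hwv]).
      simpl; lra. }
    apply Rmult_le_compat_l with (r := s ^ 2) in T; [|apply pow2_ge_0].
    eapply Rle_trans; [exact T|].
    apply Rle_trans with (s * (INR i ^ 2 * s ^ i * Cmod v ^ 2)
                          + INR i * s ^ S i * Cmod v ^ 2).
    { pose proof (pow2_ge_0 (Cmod v)); nra. }
    rewrite S_INR; simpl (s ^ S i).
    assert (0 <= s ^ i) by (apply pow_le; exact Hs).
    pose proof (pow2_ge_0 (Cmod v)); pose proof (pos_INR i).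
    assert (0 <= s * s ^ i * Cmod v ^ 2) by (apply Rmult_le_pos; [apply Rmult_le_pos|]; assumption).
    nra.
Qed.

Lemma linear_growth (s t : R) (n : nat) :
  0 < s < t -> INR n * s ^ n <= s / (t - s) * t ^ n.
Proof.
  intros Hst.
  assert (Hx : 1 + INR n * (t / s - 1) <= (t / s) ^ n).
  { replace ((t / s) ^ n) with ((1 + (t / s - 1)) ^ n) by (f_equal; ring).
    apply poly; apply Rlt_0_minus; apply Rcomplements.Rlt_div_r; lra. }
  assert (Hs : 0 < s ^ n) by (apply pow_lt; lra).
  unfold Rdiv in Hx at 2; rewrite Rpow_mult_distr, pow_inv in Hx.
  apply Rmult_le_compat_r with (r := s ^ n) in Hx; [|lra].
  rewrite Rmult_assoc, Rinv_l, Rmult_1_r in Hx by lra.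
  assert (INR n * (t / s - 1) * s ^ n <= t ^ n) by nra.
  apply Rmult_le_compat_l with (r := s / (t - s)) in H.
  - replace (s / (t - s) * (INR n * (t / s - 1) * s ^ n)) with (INR n * s ^ n) in H
      by (field; lra); exact H.
  - apply Rlt_le, Rdiv_lt_0_compat; lra.
Qed.

Lemma quadratic_growth (s t u : R) :
  0 < s < t -> t < u ->
  exists K : R, 0 < K /\ forall n, INR n ^ 2 * s ^ n <= K * u ^ n.
Proof.
  intros Hst Htu; exists (s / (t - s) * (t / (u - t))); split.
  - apply Rmult_lt_0_compat; apply Rdiv_lt_0_compat; lra.
  - intros n; pose proof (linear_growth s t n Hst) as H1.
    assert (H2 : INR n * t ^ n <= t / (u - t) * u ^ n) by (apply linear_growth; lra).
    assert (Hpos : 0 <= s / (t - s)) by (apply Rlt_le, Rdiv_lt_0_compat; lra).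
    pose proof (pos_INR n) as Hn.
    apply Rle_trans with (INR n * (s / (t - s) * t ^ n)).
    + replace (INR n ^ 2 * s ^ n) with (INR n * (INR n * s ^ n)) by ring.
      now apply Rmult_le_compat_l.
    + replace (INR n * (s / (t - s) * t ^ n)) with (s / (t - s) * (INR n * t ^ n)) by ring.
      rewrite Rmult_assoc; now apply Rmult_le_compat_l.
Qed.

Definition deriv_coef (c : nat -> C) (i : nat) : C := (INR (S i) * c (S i))%C.

(** Each term [c_i w^i] has a quadratic error at most [i^2 |c_i| s^(i-2) |v|^2], and
    these bounds are summable when [s] is below the radius of convergence. *)
Theorem power_series_derive (f : C -> C) (z0 : C) (c : nat -> C) (e : R) :
  (forall z, Cmod (z - z0) < e -> is_power_series_from 0 c (z - z0)%C (f z)) ->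
  forall z, Cmod (z - z0) < e ->
    is_power_series_from 0 (deriv_coef c) (z - z0)%C (C_derive f z).
Proof.
  intros Hf z Hz; set (w := (z - z0)%C) in *.
  pose proof (Cmod_ge_0 w) as Hw0.
  (* the spare room between [|w|] and [e] is cut in five, so that two of the
     intermediate radii can absorb the factor [i^2] *)
  set (d := (e - Cmod w) / 5).
  assert (Hd : 0 < d) by (unfold d; lra).
  set (s := Cmod w + d); set (rho := Cmod w + 4 * d).
  assert (Hs : 0 < s) by (unfold s; lra).
  assert (Hrho : 0 < rho) by (unfold rho; lra).
  destruct (power_series_coef_bound c rho (f (z0 + rho)%C)) as [A [HA HAc]].
  { exact Hrho. }
  { replace (RtoC rho) with (z0 + rho - z0)%C at 1 by ring; apply Hf.
    replace (z0 + rho - z0)%C with (RtoC rho) by ring.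
    rewrite Cmod_R, Rabs_pos_eq; unfold rho, d in *; lra. }
  destruct (quadratic_growth s (Cmod w + 2 * d) (Cmod w + 3 * d)) as [K [HK HKn]];
    [unfold s; lra | lra |].
  set (q := (Cmod w + 3 * d) / rho).
  assert (Hq : 0 <= q < 1).
  { unfold q; split; [apply Rcomplements.Rdiv_le_0_compat; lra|].
    apply Rcomplements.Rlt_div_l; [exact Hrho | unfold rho; lra]. }
  assert (Hcs : forall n, Cmod (c n) * (INR n ^ 2 * s ^ n) <= A * K * q ^ n).
  { intros n.
    apply Rle_trans with (Cmod (c n) * (K * (Cmod w + 3 * d) ^ n)).
    - apply Rmult_le_compat_l; [apply Cmod_ge_0 | apply HKn].
    - replace ((Cmod w + 3 * d) ^ n) with (rho ^ n * q ^ n).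
      + replace (Cmod (c n) * (K * (rho ^ n * q ^ n)))
          with (Cmod (c n) * rho ^ n * (K * q ^ n)) by ring.
        rewrite (Rmult_assoc A); apply Rmult_le_compat_r; [|apply HAc].
        apply Rmult_le_pos; [lra | apply pow_le; lra].
      + rewrite <- Rpow_mult_distr; f_equal; unfold q; field; lra. }
  assert (Hex : ex_series (K := C_AbsRing) (V := C_CompleteNormedModule)
                  (fun n => deriv_coef c n * w ^ n)%C).
  { apply (ex_series_le (K := C_AbsRing) (V := C_CompleteNormedModule) _
             (fun n => A * K / s * q * q ^ n)).
    - intros n; change (norm (deriv_coef c n * w ^ n)%C)
        with (Cmod (deriv_coef c n * w ^ n)%C).
      unfold deriv_coef; rewrite !Cmod_mult, Cmod_R, Cmod_pow, Rabs_pos_eq by apply pos_INR.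
      specialize (Hcs (S n)).
      assert (HS : 1 <= INR (S n)) by (rewrite S_INR; pose proof (pos_INR n); lra).
      assert (Hws : Cmod w ^ n <= s ^ n) by (apply pow_incr; unfold s; lra).
      pose proof (Cmod_ge_0 (c (S n))) as Hc0.
      apply Rmult_le_reg_r with s; [exact Hs|].
      replace (A * K / s * q * q ^ n * s) with (A * K * q ^ S n) by (simpl; field; lra).
      eapply Rle_trans; [|exact Hcs].
      apply Rle_trans with (INR (S n) * Cmod (c (S n)) * s ^ n * s).
      + apply Rmult_le_compat_r; [lra|].
        apply Rmult_le_compat_l; [|exact Hws].
        apply Rmult_le_pos; [lra | exact Hc0].
      + replace (Cmod (c (S n)) * (INR (S n) ^ 2 * s ^ S n))
          with (INR (S n) * (INR (S n) * Cmod (c (S n)) * s ^ n * s)) by (simpl; ring).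
        assert (0 <= INR (S n) * Cmod (c (S n)) * s ^ n * s).
        { repeat apply Rmult_le_pos; try lra; apply pow_le; lra. }
        nra.
    - apply (ex_series_scal (K := R_AbsRing) (V := R_NormedModule) (A * K / s * q)).
      apply ex_series_geom; rewrite Rabs_pos_eq; lra. }
  assert (Hex' : exists l : C, is_series (K := C_AbsRing) (V := C_NormedModule)
                   (fun n => deriv_coef c n * w ^ n)%C l) by exact Hex.
  destruct Hex' as [l Hl].
  assert (Hquad : forall v, Cmod v < d ->
     Cmod (f (z + v)%C - f z - v * l) <= A * K / s ^ 2 / (1 - q) * Cmod v ^ 2).
  { intros v Hv.
    assert (Hwv : Cmod (w + v) <= s).
    { eapply Rle_trans; [apply Cmod_triangle | unfold s; lra]. }
    assert (Hzv : Cmod (z + v - z0) < e).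
    { replace (z + v - z0)%C with (w + v)%C by (unfold w; ring).
      unfold s, d in *; lra. }
    pose proof (Hf (z + v)%C Hzv) as H1; pose proof (Hf z Hz) as H2.
    replace (z + v - z0)%C with (w + v)%C in H1 by (unfold w; ring); fold w in H2.
    assert (H3 : is_series (K := C_AbsRing) (V := C_NormedModule)
                   (fun n => c n * dpow n w)%C l).
    { apply (is_series_decr_1 (K := C_AbsRing) (V := C_NormedModule)).
      change plus with Cplus; change opp with Copp.
      replace (l + - (c 0%nat * dpow 0 w))%C with l by (simpl; ring).
      revert Hl; apply is_series_C_ext; intros n; unfold deriv_coef, dpow; ring. }
    pose proof (is_series_plus (K := C_AbsRing) (V := C_NormedModule) _ _ _ _
      (is_series_plus (K := C_AbsRing) (V := C_NormedModule) _ _ _ _ H1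
        (is_series_scal (K := C_AbsRing) (V := C_NormedModule) (- (1))%C _ _ H2))
      (is_series_scal (K := C_AbsRing) (V := C_NormedModule) (- v)%C _ _ H3)) as H4.
    replace (f (z + v)%C - f z - v * l)%C
      with (f (z + v)%C + - (1) * f z + - v * l - 0)%C by ring.
    apply (is_series_dist _ _ _ _ H4); intros n.
    rewrite Cminus_0_r.
    replace (A * K / s ^ 2 / (1 - q) * Cmod v ^ 2)
      with (A * K / s ^ 2 * Cmod v ^ 2 / (1 - q)) by (field; split; lra).
    apply geometric_partial_bound; [exact Hq|]; intros i.
    change plus with Cplus; change scal with Cmult; cbv beta; simpl Nat.add.
    replace (c i * (w + v) ^ i + - (1) * (c i * w ^ i) + - v * (c i * dpow i w))%C
      with (c i * ((w + v) ^ i - w ^ i - dpow i w * v))%C by ring.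
    rewrite Cmod_mult.
    assert (Hs2 : 0 < s ^ 2) by (apply pow_lt; exact Hs).
    apply Rmult_le_reg_l with (s ^ 2); [exact Hs2|].
    replace (s ^ 2 * (A * K / s ^ 2 * Cmod v ^ 2 * q ^ i))
      with (A * K * q ^ i * Cmod v ^ 2) by (field; lra).
    pose proof (dpow_error w v s i) as HE.
    assert (HE' : s ^ 2 * Cmod ((w + v) ^ i - w ^ i - dpow i w * v)
                  <= INR i ^ 2 * s ^ i * Cmod v ^ 2) by (apply HE; unfold s in *; lra).
    apply Rle_trans with (Cmod (c i) * (INR i ^ 2 * s ^ i * Cmod v ^ 2)).
    - pose proof (Cmod_ge_0 (c i)); nra.
    - pose proof (pow2_ge_0 (Cmod v)); specialize (Hcs i); nra. }
  assert (Hder : is_derive (K := C_AbsRing) (V := C_NormedModule) f z l).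
  { split; [apply is_linear_scal_l|].
    intros x Hx; apply (is_filter_lim_locally_unique (K := C_AbsRing)
      (V := AbsRing_NormedModule C_AbsRing)) in Hx; subst x.
    assert (Hnear : forall eps : posreal, exists eta : posreal, forall y : C,
              Cmod (y - z)%C < eta ->
              Cmod (f y - f z - (y - z) * l)%C <= eps * Cmod (y - z)%C).
    2:{ intros eps; destruct (Hnear eps) as [eta H]; exists eta; exact H. }
    intros eps.
    set (D := A * K / s ^ 2 / (1 - q)) in *.
    assert (HD : 0 < D).
    { unfold D; repeat apply Rdiv_lt_0_compat; try nra; apply pow_lt; lra. }
    assert (Hed : 0 < Rmin d (eps / D)).
    { apply Rmin_glb_lt; [exact Hd|]; apply Rdiv_lt_0_compat; [apply eps | exact HD]. }
    exists (mkposreal _ Hed); intros y Hy.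
    simpl in Hy.
    pose proof (Rmin_l d (eps / D)); pose proof (Rmin_r d (eps / D)).
    assert (Hyd : Cmod (y - z) < d) by lra.
    specialize (Hquad (y - z)%C Hyd); replace (z + (y - z))%C with y in Hquad by ring.
    assert (HDe : D * Cmod (y - z) <= eps).
    { apply Rle_trans with (D * (eps / D)); [apply Rmult_le_compat_l; lra|].
      right; field; lra. }
    pose proof (Cmod_ge_0 (y - z)); nra. }
  rewrite (is_C_derive_unique _ _ _ Hder); exact Hl.
Qed.

Lemma power_series_derive_n (f : C -> C) (z0 : C) (c : nat -> C) (e : R) (n : nat) :
  (forall z, Cmod (z - z0) < e -> is_power_series_from 0 c (z - z0)%C (f z)) ->
  forall z, Cmod (z - z0) < e ->
    is_power_series_from 0 (Nat.iter n deriv_coef c) (z - z0)%C (C_derive_n n f z).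
Proof.
  intros Hf; induction n as [|n IH]; [exact Hf|].
  exact (power_series_derive (C_derive_n n f) z0 _ e IH).
Qed.

Lemma iter_deriv_coef (n : nat) (c : nat -> C) :
  forall i, exists kappa : R, 0 < kappa /\
    Nat.iter n deriv_coef c i = (kappa * c (n + i)%nat)%C.
Proof.
  induction n as [|n IH]; intros i.
  - exists 1; split; [lra | simpl; ring].
  - destruct (IH (S i)) as [k [Hk E]]; exists (INR (S i) * k); split.
    + apply Rmult_lt_0_compat; [apply lt_0_INR; lia | exact Hk].
    + change (Nat.iter (S n) deriv_coef c i) with (INR (S i) * Nat.iter n deriv_coef c (S i))%C.
      rewrite E, RtoC_mult; replace (n + S i)%nat with (S n + i)%nat by lia; ring.
Qed.

Lemma C_derive_n_at_center (f : C -> C) (c : nat -> C) (e : R) (n : nat) :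
  0 < e ->
  (forall z, Cmod z < e -> is_power_series_from 0 c z (f z)) ->
  (C_derive_n n f (RtoC 0) = RtoC 0 <-> c n = RtoC 0).
Proof.
  intros He Hf.
  assert (Hf' : forall z, Cmod (z - 0) < e -> is_power_series_from 0 c (z - 0)%C (f z)).
  { intros z; replace (z - 0)%C with z by ring; apply Hf. }
  pose proof (power_series_derive_n f _ c e n Hf' (RtoC 0)) as H.
  replace (0 - 0)%C with (RtoC 0) in H by ring; rewrite Cmod_0 in H.
  rewrite (power_series_at0 _ _ (H He)).
  destruct (iter_deriv_coef n c 0) as [k [Hk E]]; rewrite Nat.add_0_r in E.
  rewrite E; split; [|intros ->; ring].
  intros H0; rewrite Cmult_comm in H0.
  apply (Cmult_eq_0_l _ (RtoC k)) in H0; [exact H0|].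
  intros Ek; apply RtoC_inj in Ek; lra.
Qed.

Lemma analytic_taylor (f : C -> C) (z0 : C) :
  analytic_in_disc f -> in_disc z0 -> taylor f z0.
Proof.
  intros Hf Hz n; destruct (Hf z0 Hz) as [c [e [He H]]]; exists c.
  apply (jet_power_series n c _ e He); intros w Hw.
  specialize (H (z0 + w)%C); replace (z0 + w - z0)%C with w in H by ring; auto.
Qed.

Lemma analytic_derive (f : C -> C) :
  analytic_in_disc f -> analytic_in_disc (C_derive f).
Proof.
  intros Hf z0 Hz; destruct (Hf z0 Hz) as [c [e [He H]]].
  exists (deriv_coef c), e; split; [exact He|].
  exact (power_series_derive f z0 c e H).
Qed.

(** * Bohr inequality and quasi-subordination *)

Lemma sup_norm_bound (f : C -> C) (B : R) :
  Rbar_le (sup_norm f) (Finite B) -> forall z, Cmod z < 1 -> Cmod (f z) <= B.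
Proof.
  intros HB z Hz.
  destruct (Lub_Rbar_correct (fun x : R => exists z : C, in_disc z /\ x = Cmod (f z)))
    as [Hub _].
  assert (H : Rbar_le (Finite (Cmod (f z))) (sup_norm f)) by (apply Hub; exists z; auto).
  exact (Rbar_le_trans _ _ _ H HB).
Qed.

Lemma schwarz_class_B_order (j : nat) (w : C -> C) (z : C) :
  class_B_order j w -> Cmod z < 1 -> Cmod (w z) <= Cmod z ^ j.
Proof.
  intros [[Han Hsup] [Hlow _]] Hz.
  assert (H0 : in_disc (RtoC 0)) by (unfold in_disc; rewrite Cmod_0; lra).
  destruct (Han _ H0) as [c [e [He Hc]]].
  assert (Hc' : forall z, Cmod z < e -> is_power_series_from 0 c z (w z)).
  { intros y Hy; specialize (Hc y); rewrite !Cminus_0_r in Hc; auto. }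
  destruct (schwarz_quotient w j c 1) as [psi [H1 [_ [H2 _]]]].
  - lra.
  - intros y Hy; now apply analytic_taylor.
  - now apply sup_norm_bound.
  - now apply jet_power_series with e.
  - intros i Hi; apply (C_derive_n_at_center w c e i He Hc'), Hlow, Hi.
  - rewrite (H1 z Hz), Cmod_mult, Cmod_pow; specialize (H2 z Hz).
    assert (0 <= Cmod z ^ j) by (apply pow_le, Cmod_ge_0); nra.
Qed.

Lemma sum_le_geometric (u : nat -> R) (D y : R) (N : nat) :
  0 <= D -> 0 <= y < 1 ->
  (forall i, (1 <= i <= N)%nat -> u i <= D * y ^ i) ->
  sum_f_R0 u N <= u 0%nat + D * (y / (1 - y)).
Proof.
  intros HD Hy Hu.
  enough (H : sum_f_R0 u N <= u 0%nat + D * ((y - y ^ S N) / (1 - y))).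
  { assert (0 <= y ^ S N) by (apply pow_le; lra).
    eapply Rle_trans; [exact H|]; apply Rplus_le_compat_l, Rmult_le_compat_l; [exact HD|].
    apply Rmult_le_compat_r; [apply Rlt_le, Rinv_0_lt_compat; lra | lra]. }
  induction N as [|N IH].
  - simpl; replace ((y - y * 1) / (1 - y)) with 0 by (field; lra); lra.
  - simpl sum_f_R0.
    assert (Hu' : u (S N) <= D * y ^ S N) by (apply Hu; lia).
    assert (IH' : sum_f_R0 u N <= u 0%nat + D * ((y - y ^ S N) / (1 - y))).
    { apply IH; intros i Hi; apply Hu; lia. }
    replace ((y - y ^ S (S N)) / (1 - y)) with ((y - y ^ S N) / (1 - y) + y ^ S N)
      by (simpl; field; lra).
    lra.
Qed.

(** The quadratic inequality [t + (B^2 - t^2) / (2 B) <= B] is what makes [1/3]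
    the critical radius, since [y / (1 - y) <= 1/2] there. *)
Lemma bohr_radius_third (F : C -> C) (c : nat -> C) (M B y : R) (N : nat) :
  0 <= M < B -> 0 <= y <= / 3 ->
  (forall z, Cmod z < 1 -> taylor F z) ->
  (forall z, Cmod z < 1 -> Cmod (F z) <= M) ->
  jet (S N) c F ->
  sum_f_R0 (fun i => Cmod (c i) * y ^ i) N <= B.
Proof.
  intros HMB Hy HF HM Hj.
  set (t := Cmod (c 0%nat)).
  assert (Ht0 : 0 <= t) by apply Cmod_ge_0.
  assert (Ht : t <= M).
  { unfold t; rewrite <- (jet_at0 _ _ _ Hj); apply HM; rewrite Cmod_0; lra. }
  set (D := (B ^ 2 - t ^ 2) / B).
  assert (HBD : B * D = B ^ 2 - t ^ 2) by (unfold D; field; lra).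
  assert (HD : 0 <= D) by nra.
  eapply Rle_trans.
  - apply (sum_le_geometric _ D y N HD); [lra|].
    intros i Hi; apply Rmult_le_compat_r; [apply pow_le; lra|].
    apply Rmult_le_reg_l with B; [lra|]; rewrite HBD.
    apply (bounded_coef F i c M B); try assumption; try lia; try lra.
    apply (jet_le (S i) (S N)); [lia | exact Hj].
  - simpl; rewrite Rmult_1_r; fold t.
    assert (Hy2 : y / (1 - y) <= / 2).
    { apply Rcomplements.Rle_div_l; lra. }
    assert (D * (y / (1 - y)) <= D * / 2) by (apply Rmult_le_compat_l; lra).
    nra.
Qed.

(** Majorant series of a product, with weights [v]. As the weights decrease,
    the weight of [q i * c j] may be replaced by that of [q i] alone. *)
Lemma conv_majorant (c : nat -> C) (y : R) (Hy : 0 <= y) (N : nat) :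
  forall (q : nat -> C) (v : nat -> R),
  (forall i, 0 <= v (S i) <= v i) ->
  sum_f_R0 (fun n => Cmod (conv q c n) * v n * y ^ n) N
  <= sum_f_R0 (fun i => Cmod (q i) * v i * y ^ i) N
     * sum_f_R0 (fun j => Cmod (c j) * y ^ j) N.
Proof.
  assert (Hyp : forall n, 0 <= y ^ n) by (intros; now apply pow_le).
  induction N as [|N IH]; intros q v Hv.
  - simpl; rewrite Cmod_mult; right; ring.
  - set (S1 := sum_f_R0 (fun j => Cmod (c j) * y ^ j) (S N)).
    assert (Hshift : forall u, sum_f_R0 u (S N) = u 0%nat + sum_f_R0 (fun i => u (S i)) N).
    { intros u; rewrite decomp_sum by lia; reflexivity. }
    assert (HSle : sum_f_R0 (fun j => Cmod (c j) * y ^ j) N <= S1).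
    { unfold S1; simpl.
      assert (0 <= Cmod (c (S N)) * y ^ S N) by (apply Rmult_le_pos; [apply Cmod_ge_0 | apply Hyp]).
      simpl in *; lra. }
    assert (Hdecr : forall i, v i <= v 0%nat).
    { induction i as [|i IHi]; [lra|]; specialize (Hv i); lra. }
    assert (Hpos : forall i, 0 <= v i) by (intros i; specialize (Hv i); lra).
    rewrite (Hshift (fun n => Cmod (conv q c n) * v n * y ^ n)).
    rewrite (Hshift (fun n => Cmod (q n) * v n * y ^ n)).
    set (q' := fun i => q (S i)); set (v' := fun i => v (S i)).
    assert (IH' := IH q' v' (fun i => Hv (S i))).
    assert (T : sum_f_R0 (fun i => Cmod (conv q c (S i)) * v (S i) * y ^ S i) N
      <= Cmod (q 0%nat) * v 0%nat * sum_f_R0 (fun i => Cmod (c (S i)) * y ^ S i) N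
         + y * sum_f_R0 (fun n => Cmod (conv q' c n) * v' n * y ^ n) N).
    { rewrite !scal_sum, <- sum_plus; apply sum_Rle; intros i _.
      change (conv q c (S i)) with (q 0%nat * c (S i) + conv q' c i)%C.
      assert (T1 : Cmod (q 0%nat * c (S i) + conv q' c i)
                   <= Cmod (q 0%nat) * Cmod (c (S i)) + Cmod (conv q' c i)).
      { eapply Rle_trans; [apply Cmod_triangle|]; rewrite Cmod_mult; lra. }
      assert (Hw : 0 <= v (S i) * y ^ S i) by (apply Rmult_le_pos; auto).
      apply Rle_trans with ((Cmod (q 0%nat) * Cmod (c (S i)) + Cmod (conv q' c i))
                            * (v (S i) * y ^ S i)).
      { rewrite Rmult_assoc; now apply Rmult_le_compat_r. }
      assert (Cmod (q 0%nat) * Cmod (c (S i)) * y ^ S i * v (S i)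
              <= Cmod (q 0%nat) * Cmod (c (S i)) * y ^ S i * v 0%nat).
      { apply Rmult_le_compat_l; [|apply Hdecr].
        repeat apply Rmult_le_pos; auto using Cmod_ge_0. }
      unfold v'; simpl pow in *; lra. }
    assert (Hq' : sum_f_R0 (fun i => Cmod (q (S i)) * v (S i) * y ^ S i) N
                  = y * sum_f_R0 (fun i => Cmod (q' i) * v' i * y ^ i) N).
    { rewrite scal_sum; apply sum_eq; intros i _; unfold q', v'; simpl; ring. }
    rewrite Hq'.
    set (Q := sum_f_R0 (fun i => Cmod (q' i) * v' i * y ^ i) N) in *.
    assert (HQ : 0 <= Q).
    { apply cond_pos_sum; intros i; repeat apply Rmult_le_pos; auto using Cmod_ge_0.
      apply Hpos. }
    assert (HS1 : S1 = Cmod (c 0%nat) * y ^ 0 + sum_f_R0 (fun i => Cmod (c (S i)) * y ^ S i) N).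
    { unfold S1; now rewrite Hshift. }
    assert (HQS : y * sum_f_R0 (fun n => Cmod (conv q' c n) * v' n * y ^ n) N <= y * (Q * S1)).
    { apply Rmult_le_compat_l; [exact Hy|]; eapply Rle_trans; [exact IH'|].
      now apply Rmult_le_compat_l. }
    simpl (conv q c 0%nat); rewrite Cmod_mult.
    replace ((Cmod (q 0%nat) * v 0%nat * y ^ 0 + y * Q) * S1)
      with (Cmod (q 0%nat) * v 0%nat * S1 + y * (Q * S1)) by (simpl; ring).
    rewrite HS1 at 1.
    simpl pow in *; lra.
Qed.

(** By the Schwarz lemma [P = z phi Q] with [|phi| <= k], and the coefficients of
    [phi] obey Bohr's inequality. As [phi] is known through finite expansions
    only, its coefficients are supplied up to a given order. *)
Lemma dominated_factorization (P Q : C -> C) (s q : nat -> C) (k B : R) (N : nat) :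
  0 <= k < B ->
  (forall z, Cmod z < 1 -> taylor P z) ->
  (forall z, Cmod z < 1 -> taylor Q z) ->
  (forall z, Cmod z < 1 -> Q z <> RtoC 0) ->
  (forall z, Cmod z < 1 -> Cmod (P z / Q z) <= k) ->
  jet (S (S N)) s P -> jet (S N) q Q -> s 0%nat = RtoC 0 ->
  exists c : nat -> C,
    (forall i, (i <= N)%nat -> s (S i) = conv q c i) /\
    forall y, 0 <= y <= / 3 -> sum_f_R0 (fun i => Cmod (c i) * y ^ i) N <= B.
Proof.
  intros Hk HP HQ HQ0 HPQ Hs Hq Hs0.
  assert (H01 : Cmod (RtoC 0) < 1) by (rewrite Cmod_0; lra).
  assert (Hrecenter : forall f n c, jet n c (fun w => f (0 + w)%C) -> jet n c f).
  { intros f n c; apply jet_ext; [reflexivity|].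
    apply near0_all; intros w; f_equal; ring. }
  set (F := fun z => (P z * / Q z)%C).
  assert (HF : forall z, Cmod z < 1 -> taylor F z).
  { intros z Hz; apply taylor_mult; [now apply HP|]; apply taylor_inv; auto. }
  destruct (HF _ H01 2%nat) as [d Hd]; apply Hrecenter in Hd.
  destruct (schwarz_quotient F 1 d k) as [phi [Hphi [Hphit [Hphik _]]]];
    try assumption; [lra | |].
  { intros [|i] Hi; [|lia].
    rewrite <- (jet_at0 _ _ _ Hd); unfold F.
    rewrite (jet_at0 _ _ _ Hs), Hs0; ring. }
  destruct (Hphit _ H01 (S N)) as [c Hc]; apply Hrecenter in Hc.
  exists c; split.
  - pose proof (jet_mult _ _ _ _ _ Hq Hc) as Hprod.
    assert (HP' : jet (S (S N)) (fun i => match i with O => RtoC 0 | S j => conv q c j end) P).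
    { exists (fun w => (Q w * phi w)%C); split; [|exact Hprod].
      exists 1; split; [lra|]; intros w Hw.
      specialize (Hphi w Hw); unfold F in Hphi.
      replace (P w) with (P w * / Q w * Q w)%C by (field; auto).
      rewrite Hphi; simpl; ring. }
    intros i Hi.
    apply (jet_unique _ _ _ _ _ Hs HP'); [|lia].
    apply near0_all; auto.
  - intros y Hy; now apply (bohr_radius_third phi c k B y N).
Qed.

(** * The logarithmic function of the radius equation *)

Definition log_part (y : R) : R := y / (1 - y) + ln (1 - y).

Definition log_part_sum (y : R) (N : nat) : R :=
  sum_f_R0 (fun i => INR (S i) / INR (S (S i)) * y ^ S (S i)) N.

Lemma is_derive_log_part (x : R) :
  x < 1 -> is_derive log_part x (x / (1 - x) ^ 2).
Proof.
  intros Hx; unfold log_part; auto_derive; [repeat split; lra|].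
  field; lra.
Qed.

Lemma is_derive_log_part_sum (x : R) (N : nat) :
  is_derive (fun y => log_part_sum y N) x (sum_f_R0 (fun i => INR (S i) * x ^ S i) N).
Proof.
  assert (Hterm : forall i, is_derive (fun y => INR (S i) / INR (S (S i)) * y ^ S (S i)) x
                              (INR (S i) * x ^ S i)).
  { intros i.
    assert (0 < INR (S (S i))) by (apply lt_0_INR; lia).
    auto_derive; [trivial|].
    change (pred (S (S i))) with (S i); set (a := INR (S (S i))) in *.
    change (INR (S i) / a * (1 * (a * x ^ S i)) = INR (S i) * x ^ S i).
    field; lra. }
  induction N as [|N IH].
  - exact (Hterm 0%nat).
  - exact (is_derive_plus (K := R_AbsRing) (V := R_NormedModule) _ _ _ _ _
             IH (Hterm (S N))).
Qed.

Lemma arithmetic_geometric_remainder (x : R) (N : nat) :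
  x < 1 ->
  x / (1 - x) ^ 2 - sum_f_R0 (fun i => INR (S i) * x ^ S i) N
  = x ^ S (S N) * (INR (S (S N)) - INR (S N) * x) / (1 - x) ^ 2.
Proof.
  intros Hx; induction N as [|N IH].
  - simpl; field; lra.
  - change (sum_f_R0 (fun i => INR (S i) * x ^ S i) (S N))
      with (sum_f_R0 (fun i => INR (S i) * x ^ S i) N + INR (S (S N)) * x ^ S (S N)).
    set (s := sum_f_R0 _ _) in *.
    replace s with (x / (1 - x) ^ 2
      - x ^ S (S N) * (INR (S (S N)) - INR (S N) * x) / (1 - x) ^ 2) by lra.
    rewrite !S_INR; simpl pow; field; lra.
Qed.

(** The derivative of the difference is the tail of an arithmetico-geometric
    series, which has a closed form. *)
Lemma log_part_remainder (y : R) (N : nat) :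
  0 <= y < 1 ->
  0 <= log_part y - log_part_sum y N <= INR (S (S N)) * y ^ S (S N) / (1 - y) ^ 2.
Proof.
  intros Hy.
  assert (Hder : forall x, x < 1 -> is_derive (fun t => log_part t - log_part_sum t N) x
            (x ^ S (S N) * (INR (S (S N)) - INR (S N) * x) / (1 - x) ^ 2)).
  { intros x Hx; rewrite <- arithmetic_geometric_remainder by exact Hx.
    apply (is_derive_minus (K := R_AbsRing) (V := R_NormedModule));
      [now apply is_derive_log_part | apply is_derive_log_part_sum]. }
  destruct (MVT_gen (fun t => log_part t - log_part_sum t N) 0 y
     (fun x => x ^ S (S N) * (INR (S (S N)) - INR (S N) * x) / (1 - x) ^ 2))
    as [x [Hx E]].
  - intros x Hx; apply Hder; rewrite Rmax_right in Hx by lra; lra.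
  - intros x Hx; rewrite Rmax_right in Hx by lra.
    apply continuity_pt_filterlim.
    apply (ex_derive_continuous (K := R_AbsRing) (V := R_NormedModule)
             (fun t => log_part t - log_part_sum t N)).
    eexists; apply Hder; lra.
  - rewrite Rmin_left, Rmax_right in Hx by lra; cbv beta in E.
    assert (E0 : log_part 0 - log_part_sum 0 N = 0).
    { assert (Hs : log_part_sum 0 N = 0).
      { unfold log_part_sum; apply sum_eq_R0; intros i _; simpl; ring. }
      rewrite Hs; unfold log_part; replace (1 - 0) with 1 by ring; rewrite ln_1; field. }
    assert (E' : log_part y - log_part_sum y N
                 = x ^ S (S N) * (INR (S (S N)) - INR (S N) * x) / (1 - x) ^ 2 * y) by lra.
    rewrite E'; clear E E' E0 Hder.
    pose proof (pos_INR (S N)) as HN; rewrite (S_INR (S N)) in *.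
    assert (H1 : 0 <= x ^ S (S N) <= y ^ S (S N)).
    { split; [apply pow_le; lra | apply pow_incr; lra]. }
    assert (H2 : 0 <= INR (S N) + 1 - INR (S N) * x <= INR (S N) + 1) by nra.
    assert (H3 : 0 < (1 - y) ^ 2 <= (1 - x) ^ 2).
    { split; [apply pow_lt; lra | apply pow_incr; lra]. }
    assert (H4 : 0 < / (1 - x) ^ 2 <= / (1 - y) ^ 2).
    { split; [apply Rinv_0_lt_compat; lra | apply Rinv_le_contravar; lra]. }
    set (A := x ^ S (S N)) in *; set (A' := y ^ S (S N)) in *.
    set (U := INR (S N) + 1 - INR (S N) * x) in *; set (U' := INR (S N) + 1) in *.
    assert (HAU : 0 <= A * U <= U' * A').
    { split; [apply Rmult_le_pos; lra|].
      rewrite (Rmult_comm U'); apply Rmult_le_compat; lra. }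
    assert (HAUV : 0 <= A * U / (1 - x) ^ 2 <= U' * A' / (1 - y) ^ 2).
    { split; [apply Rmult_le_pos; lra | apply Rmult_le_compat; lra]. }
    nra.
Qed.

Lemma log_part_le (x y : R) : 0 <= x <= y -> y < 1 -> log_part x <= log_part y.
Proof.
  intros Hxy Hy1.
  destruct (MVT_gen log_part x y (fun t => t / (1 - t) ^ 2)) as [t [Ht E]].
  - intros t Ht; apply is_derive_log_part; rewrite Rmax_right in Ht by lra; lra.
  - intros t Ht; rewrite Rmax_right in Ht by lra.
    apply continuity_pt_filterlim.
    apply (ex_derive_continuous (K := R_AbsRing) (V := R_NormedModule) log_part).
    eexists; apply is_derive_log_part; lra.
  - rewrite Rmin_left, Rmax_right in Ht by lra.
    assert (0 <= t / (1 - t) ^ 2).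
    { apply Rcomplements.Rdiv_le_0_compat; [lra | apply pow_lt; lra]. }
    nra.
Qed.

Lemma log_part_nonneg (y : R) : 0 <= y < 1 -> 0 <= log_part y.
Proof.
  intros Hy; pose proof (log_part_le 0 y).
  assert (log_part 0 = 0) by (unfold log_part; rewrite Rminus_0_r, ln_1; field).
  lra.
Qed.

(** * The radius equation *)

Lemma pow_lt_strict (x y : R) (n : nat) :
  0 <= x < y -> (1 <= n)%nat -> x ^ n < y ^ n.
Proof.
  intros Hxy Hn; destruct n as [|n]; [lia|]; clear Hn.
  induction n as [|n IH]; [simpl; lra|].
  change (x * x ^ S n < y * y ^ S n).
  assert (0 <= x ^ S n) by (apply pow_le; lra); nra.
Qed.

Lemma pow_unit_lt_1 (x : R) (n : nat) : 0 <= x < 1 -> (1 <= n)%nat -> x ^ n < 1.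
Proof. intros Hx Hn; rewrite <- (pow1 n); apply pow_lt_strict; [lra | exact Hn]. Qed.

Lemma ratio_le (x y : R) : x <= y -> y < 1 -> x / (1 - x) <= y / (1 - y).
Proof.
  intros Hxy Hy.
  assert (E : y / (1 - y) - x / (1 - x) = (y - x) / ((1 - x) * (1 - y))) by (field; lra).
  assert (0 <= (y - x) / ((1 - x) * (1 - y))).
  { apply Rcomplements.Rdiv_le_0_compat; [lra | apply Rmult_lt_0_compat; lra]. }
  lra.
Qed.

Lemma ratio_lt (x y : R) : x < y -> y < 1 -> x / (1 - x) < y / (1 - y).
Proof.
  intros Hxy Hy.
  assert (E : y / (1 - y) - x / (1 - x) = (y - x) / ((1 - x) * (1 - y))) by (field; lra).
  assert (0 < (y - x) / ((1 - x) * (1 - y))).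
  { apply Rdiv_lt_0_compat; [lra | apply Rmult_lt_0_compat; lra]. }
  lra.
Qed.

Lemma radius_eq_lhs_alt (p m : nat) (k r : R) :
  radius_eq_lhs p m k r
  = 2 * (r ^ p / (1 - r ^ p) + k * log_part (r ^ m)) - 1.
Proof. unfold radius_eq_lhs, log_part, Rdiv; ring. Qed.

Lemma radius_eq_lhs_lt (p m : nat) (k x y : R) :
  (1 <= p)%nat -> (1 <= m)%nat -> 0 <= k -> 0 <= x < y -> y < 1 ->
  radius_eq_lhs p m k x < radius_eq_lhs p m k y.
Proof.
  intros Hp Hm Hk Hxy Hy; rewrite !radius_eq_lhs_alt.
  assert (Hyp : y ^ p < 1) by (apply pow_unit_lt_1; [lra | exact Hp]).
  assert (Hym : y ^ m < 1) by (apply pow_unit_lt_1; [lra | exact Hm]).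
  pose proof (ratio_lt (x ^ p) (y ^ p) (pow_lt_strict x y p Hxy Hp) Hyp).
  assert (Hlog : log_part (x ^ m) <= log_part (y ^ m)).
  { apply log_part_le; [|exact Hym]; split; [apply pow_le; lra|].
    apply pow_incr; lra. }
  nra.
Qed.

Lemma radius_eq_root_exists (p m : nat) (k : R) :
  (1 <= p)%nat -> (1 <= m)%nat -> 0 <= k -> exists r : R, is_smallest_root p m k r.
Proof.
  intros Hp Hm Hk.
  assert (Hp0 : 1 <= INR p) by (apply (le_INR 1 p); exact Hp).
  (* by Bernoulli's inequality [s ^ p >= 1/2], so the first term is at least [2] *)
  set (s := 1 - / (2 * INR p)).
  assert (Hinv : 0 < / (2 * INR p) <= / 2).
  { split; [apply Rinv_0_lt_compat; lra | apply Rinv_le_contravar; lra]. }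
  assert (Hs : 0 < s < 1) by (unfold s; lra).
  assert (Hsp : / 2 <= s ^ p).
  { pose proof (bernoulli_below p (/ (2 * INR p))) as H.
    replace (INR p * / (2 * INR p)) with (/ 2) in H by (field; lra).
    unfold s; lra. }
  assert (H0 : radius_eq_lhs p m k 0 < 0).
  { rewrite radius_eq_lhs_alt, !pow_ne_zero by lia.
    assert (log_part 0 = 0) by (unfold log_part; replace (1 - 0) with 1 by ring; rewrite ln_1; field).
    rewrite H; lra. }
  assert (H1 : 0 < radius_eq_lhs p m k s).
  { rewrite radius_eq_lhs_alt.
    assert (Hs1 : s ^ p < 1) by (apply pow_unit_lt_1; [lra | exact Hp]).
    assert (Hs2 : s ^ m < 1) by (apply pow_unit_lt_1; [lra | exact Hm]).
    pose proof (ratio_le (/ 2) (s ^ p) Hsp Hs1) as H.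
    assert (0 <= log_part (s ^ m)) by (apply log_part_nonneg; split; [apply pow_le; lra | lra]).
    replace (/ 2 / (1 - / 2)) with 1 in H by field; nra. }
  destruct (IVT_interv (radius_eq_lhs p m k) 0 s) as [r [Hr E]]; try lra.
  - intros x Hx; apply continuity_pt_filterlim.
    apply (ex_derive_continuous (K := R_AbsRing) (V := R_NormedModule) (radius_eq_lhs p m k)).
    assert (x ^ p < 1) by (apply pow_unit_lt_1; [lra | exact Hp]).
    assert (x ^ m < 1) by (apply pow_unit_lt_1; [lra | exact Hm]).
    unfold radius_eq_lhs; auto_derive; repeat split; lra.
  - assert (Hr0 : r <> 0) by (intros ->; lra).
    exists r; split; [lra|]; split; [exact E|].
    intros x Hx; pose proof (radius_eq_lhs_lt p m k x r Hp Hm Hk); lra.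
Qed.

Lemma third_root_pow (m : nat) (x : R) :
  (1 <= m)%nat -> 0 <= x <= 1 / Rpower 3 (1 / INR m) -> x ^ m <= / 3.
Proof.
  intros Hm Hx.
  assert (Hm0 : 0 < INR m) by (apply lt_0_INR; lia).
  apply Rle_trans with ((1 / Rpower 3 (1 / INR m)) ^ m); [now apply pow_incr|].
  unfold Rdiv; rewrite !Rmult_1_l, pow_inv, <- Rpower_pow by apply exp_pos.
  rewrite Rpower_mult, Rinv_l, Rpower_1; lra.
Qed.

(** * The inequality below the radius *)

Lemma Lim_seq_le_const (u : nat -> R) (U : R) :
  (forall n, u n <= U) -> Rbar_le (Lim_seq u) U.
Proof.
  intros H; rewrite <- (Lim_seq_const U); apply Lim_seq_le_loc; exists 0%nat; auto.
Qed.

Lemma sup_norm_finite (f : C -> C) :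
  bounded_in_disc f -> exists H : R, 0 <= H /\ sup_norm f = Finite H.
Proof.
  intros [M HM].
  destruct (Lub_Rbar_correct (fun x : R => exists z : C, in_disc z /\ x = Cmod (f z)))
    as [Hub Hlub]; fold (sup_norm f) in *.
  assert (H0 : Rbar_le (Finite (Cmod (f (RtoC 0)))) (sup_norm f)).
  { apply Hub; exists (RtoC 0); split; [|reflexivity].
    unfold in_disc; rewrite Cmod_0; lra. }
  assert (H1 : Rbar_le (sup_norm f) (Finite M)).
  { apply Hlub; intros x [z [Hz ->]]; apply HM, Hz. }
  destruct (sup_norm f) as [H | |]; try contradiction.
  exists H; split; [|reflexivity]; simpl in H0.
  pose proof (Cmod_ge_0 (f (RtoC 0))); lra.
Qed.

Definition tail2 (b : nat -> C) (i : nat) : C :=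
  match i with O => RtoC 0 | S O => RtoC 0 | _ => b i end.

Lemma power_series_tail2 (b : nat -> C) (z l : C) :
  is_power_series_from 2 b z l -> is_power_series_from 0 (tail2 b) z l.
Proof.
  intros H; unfold is_power_series_from in *; simpl Nat.add in *.
  apply (is_series_decr_1 (K := C_AbsRing) (V := C_NormedModule)).
  apply (is_series_decr_1 (K := C_AbsRing) (V := C_NormedModule)).
  change plus with Cplus; change opp with Copp; simpl tail2.
  replace (l + - (0 * z ^ 0) + - (0 * z ^ 1))%C with l by ring.
  exact H.
Qed.

Lemma le_of_all_above (x k : R) (X : R) :
  0 <= X -> (forall B, k < B -> x <= X * B) -> x <= X * k.
Proof.
  intros HX H; apply le_epsilon; intros eps Heps.
  assert (Hd : 0 < eps / (X + 1)) by (apply Rdiv_lt_0_compat; lra).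
  eapply Rle_trans; [apply (H (k + eps / (X + 1))); lra|].
  rewrite Rmult_plus_distr_l; apply Rplus_le_compat_l.
  replace (X * (eps / (X + 1))) with (eps * (X / (X + 1))) by (field; lra).
  rewrite <- (Rmult_1_r eps) at 2; apply Rmult_le_compat_l; [lra|].
  apply Rcomplements.Rle_div_l; lra.
Qed.

(** Comparing coefficients in [g' = z phi h'] gives
    [(i+2) b_(i+2) = sum_j (j+1) a_(j+1) phi_(i-j)], to which the majorant
    estimate applies with weights [1/(i+2)]; the factor [1/(i+2)] accounts for
    passing from [g'] to [g]. *)
Lemma coanalytic_partial_sum (h g : C -> C) (a b : nat -> C) (k D y : R) (N : nat) :
  analytic_in_disc h -> analytic_in_disc g -> has_expansions h g a b ->
  (forall z, Cmod z < 1 -> C_derive h z <> RtoC 0) ->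
  (forall z, Cmod z < 1 -> Cmod (C_derive g z / C_derive h z) <= k) ->
  0 <= k -> 0 <= y <= / 3 -> 0 <= D -> (forall i, Cmod (a (S i)) <= D) ->
  sum_f_R0 (fun i => Cmod (b (2 + i)%nat) * y ^ (2 + i)) N <= D * log_part_sum y N * k.
Proof.
  intros Hh Hg Hexp Hh0 Hq Hk Hy HD Ha.
  assert (Hs1 : forall z, Cmod z < 1 ->
            is_power_series_from 0 (deriv_coef (tail2 b)) z (C_derive g z)).
  { intros z Hz; pose proof (power_series_derive g (RtoC 0) (tail2 b) 1) as H.
    rewrite <- (Cminus_0_r z) in Hz |- * at 1; apply H; [|exact Hz].
    intros y0 Hy0; rewrite Cminus_0_r in *.
    apply power_series_tail2, Hexp, Hy0. }
  assert (Hq1 : forall z, Cmod z < 1 ->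
            is_power_series_from 0 (deriv_coef a) z (C_derive h z)).
  { intros z Hz; pose proof (power_series_derive h (RtoC 0) a 1) as H.
    rewrite <- (Cminus_0_r z) in Hz |- * at 1; apply H; [|exact Hz].
    intros y0 Hy0; rewrite Cminus_0_r in *; apply Hexp, Hy0. }
  assert (Hlog0 : 0 <= log_part_sum y N).
  { apply cond_pos_sum; intros i; apply Rmult_le_pos; [|apply pow_le; lra].
    apply Rcomplements.Rdiv_le_0_compat; [apply pos_INR | apply lt_0_INR; lia]. }
  apply le_of_all_above; [now apply Rmult_le_pos|].
  intros B HB.
  destruct (dominated_factorization (C_derive g) (C_derive h)
     (deriv_coef (tail2 b)) (deriv_coef a) k B N) as [c [Hc Hbohr]]; try assumption.
  - lra.
  - intros z Hz; apply analytic_taylor; [now apply analytic_derive | exact Hz].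
  - intros z Hz; apply analytic_taylor; [now apply analytic_derive | exact Hz].
  - apply jet_power_series with 1; [lra | exact Hs1].
  - apply jet_power_series with 1; [lra | exact Hq1].
  - unfold deriv_coef; simpl; ring.
  - set (v := fun i : nat => / INR (S (S i))).
    assert (Hv : forall i, 0 <= v (S i) <= v i).
    { intros i; unfold v; assert (0 < INR (S (S i))) by (apply lt_0_INR; lia).
      rewrite (S_INR (S (S i))); split.
      - apply Rlt_le, Rinv_0_lt_compat; lra.
      - apply Rinv_le_contravar; lra. }
    assert (Hb : sum_f_R0 (fun i => Cmod (b (2 + i)%nat) * y ^ (2 + i)) N
                 = y ^ 2 * sum_f_R0 (fun n => Cmod (conv (deriv_coef a) c n) * v n * y ^ n) N).
    { rewrite scal_sum; apply sum_eq; intros i Hi.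
      rewrite <- Hc by exact Hi; unfold deriv_coef, v, tail2.
      assert (0 < INR (S (S i))) by (apply lt_0_INR; lia).
      rewrite Cmod_mult, Cmod_R, Rabs_pos_eq by lra.
      rewrite pow_add; simpl Nat.add; field; lra. }
    assert (HA : y ^ 2 * sum_f_R0 (fun i => Cmod (deriv_coef a i) * v i * y ^ i) N
                 <= D * log_part_sum y N).
    { unfold log_part_sum; rewrite !scal_sum; apply sum_Rle; intros i Hi.
      unfold deriv_coef, v.
      rewrite Cmod_mult, Cmod_R, Rabs_pos_eq by apply pos_INR.
      assert (0 < INR (S (S i))) by (apply lt_0_INR; lia).
      replace (INR (S i) * Cmod (a (S i)) * / INR (S (S i)) * y ^ i * y ^ 2)
        with (INR (S i) / INR (S (S i)) * y ^ S (S i) * Cmod (a (S i)))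
        by (simpl pow; field; lra).
      apply Rmult_le_compat_l; [|apply Ha].
      apply Rmult_le_pos; [|apply pow_le; lra].
      apply Rcomplements.Rdiv_le_0_compat; [apply pos_INR | lra]. }
    rewrite Hb.
    pose proof (conv_majorant c y (proj1 Hy) N (deriv_coef a) v Hv) as HM.
    specialize (Hbohr y Hy).
    set (SA := sum_f_R0 (fun i => Cmod (deriv_coef a i) * v i * y ^ i) N) in *.
    assert (HSA : 0 <= SA).
    { apply cond_pos_sum; intros i.
      repeat apply Rmult_le_pos; [apply Cmod_ge_0 | | apply pow_le; lra].
      specialize (Hv i); lra. }
    assert (Hy2 : 0 <= y ^ 2) by apply pow2_ge_0.
    apply Rle_trans with (y ^ 2 * (SA * B)).
    + apply Rmult_le_compat_l; [exact Hy2|]; eapply Rle_trans; [exact HM|].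
      now apply Rmult_le_compat_l.
    + rewrite <- Rmult_assoc; apply Rmult_le_compat_r; lra.
Qed.

(** With [t = |a_0|] both sums together are at most
    [t + (B - t^2 / B) * (1/2) <= B] for every [B] above the norm of [h]. *)
Lemma bohr_inequality_below_radius (K k : R) (p m : nat) (r : R)
    (f h g : C -> C) (a b : nat -> C) (omega : nat -> C -> C) (z : C) :
  k = (K - 1) / (K + 1) -> 0 <= k -> (1 <= p)%nat -> (1 <= m)%nat ->
  is_smallest_root p m k r ->
  sense_preserving_qc_harmonic K f h g -> has_expansions h g a b ->
  bounded_in_disc h ->
  (forall j : nat, (1 <= j)%nat -> class_B_order j (omega j)) ->
  Cmod z <= Rmin r (1 / Rpower 3 (1 / INR m)) ->
  bohr_inequality h a b (Cmod (omega p z)) (Cmod (omega m z)).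
Proof.
  intros HkK Hk Hp Hm [Hr [Hroot _]] [[[Hh [Hg _]] Hsp] Hqc] Hexp Hbound Hom Hz.
  rewrite <- HkK in Hqc.
  assert (Hzr : Cmod z <= r) by (eapply Rle_trans; [exact Hz | apply Rmin_l]).
  assert (Hz3 : Cmod z <= 1 / Rpower 3 (1 / INR m))
    by (eapply Rle_trans; [exact Hz | apply Rmin_r]).
  pose proof (Cmod_ge_0 z) as Hz0; clear Hz.
  set (X := Cmod z ^ p); set (Y := Cmod z ^ m).
  assert (HX : 0 <= X < 1).
  { split; [now apply pow_le | apply pow_unit_lt_1; [lra | exact Hp]]. }
  assert (HY : 0 <= Y <= / 3).
  { split; [now apply pow_le | apply third_root_pow; [exact Hm | lra]]. }
  assert (Hlhs : X / (1 - X) + k * log_part Y <= / 2).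
  { assert (H : radius_eq_lhs p m k (Cmod z) <= 0).
    { destruct (Rle_lt_or_eq_dec _ _ Hzr) as [Hlt | ->]; [|lra].
      pose proof (radius_eq_lhs_lt p m k (Cmod z) r Hp Hm Hk); lra. }
    rewrite radius_eq_lhs_alt in H; fold X Y in H; lra. }
  set (x := Cmod (omega p z)); set (y := Cmod (omega m z)).
  assert (Hx : 0 <= x <= X).
  { split; [apply Cmod_ge_0 | apply schwarz_class_B_order; [now apply Hom | lra]]. }
  assert (Hy : 0 <= y <= Y).
  { split; [apply Cmod_ge_0 | apply schwarz_class_B_order; [now apply Hom | lra]]. }
  destruct (sup_norm_finite h Hbound) as [H [HH0 HH]].
  assert (HhH : forall w, Cmod w < 1 -> Cmod (h w) <= H).
  { apply sup_norm_bound; rewrite HH; apply Rbar_le_refl. }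
  assert (Hjet : forall n, jet n a h).
  { intros n; apply jet_power_series with 1; [lra|]; intros w Hw; apply Hexp, Hw. }
  assert (Hh0 : forall w, Cmod w < 1 -> C_derive h w <> RtoC 0).
  { intros w Hw E; specialize (Hsp w Hw); rewrite E, Cmod_0 in Hsp.
    pose proof (pow2_ge_0 (Cmod (C_derive g w))); simpl in *; lra. }
  set (t := Cmod (a 0%nat)).
  assert (Ht : 0 <= t <= H).
  { split; [apply Cmod_ge_0|]; unfold t; rewrite <- (jet_at0 _ _ _ (Hjet 1%nat)).
    apply HhH; rewrite Cmod_0; lra. }
  assert (HB : forall B, H < B ->
     Rbar_le (Rbar_plus (abs_power_series_from 0 a x) (abs_power_series_from 2 b y)) B).
  { intros B HHB.
    set (D := (B ^ 2 - t ^ 2) / B).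
    assert (HBD : B * D = B ^ 2 - t ^ 2) by (unfold D; field; lra).
    assert (HD : 0 <= D) by nra.
    assert (HaD : forall i, Cmod (a (S i)) <= D).
    { intros i; apply Rmult_le_reg_l with B; [lra|]; rewrite HBD.
      apply (bounded_coef h (S i) a H B); try assumption; [lia | | apply Hjet].
      intros w Hw; now apply analytic_taylor. }
    assert (Hsum : t + D * (X / (1 - X)) + D * log_part Y * k <= B).
    { assert (D * (X / (1 - X) + k * log_part Y) <= D * / 2)
        by now apply Rmult_le_compat_l.
      nra. }
    apply Rbar_le_trans with (Finite (t + D * (X / (1 - X)) + D * log_part Y * k));
      [|exact Hsum].
    change (Finite (t + D * (X / (1 - X)) + D * log_part Y * k))
      with (Rbar_plus (Finite (t + D * (X / (1 - X)))) (Finite (D * log_part Y * k))).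
    apply Rbar_plus_le_compat; apply Lim_seq_le_const; intros N; rewrite sum_n_Reals.
    - eapply Rle_trans.
      + apply (sum_le_geometric _ D x N HD); [lra|].
        intros [|i] Hi; [lia|]; apply Rmult_le_compat_r; [apply pow_le; lra | apply HaD].
      + assert (Hxx : x / (1 - x) <= X / (1 - X)) by (apply ratio_le; lra).
        apply Rplus_le_compat; [simpl; unfold t; lra|].
        now apply Rmult_le_compat_l.
    - eapply Rle_trans.
      + apply (coanalytic_partial_sum h g a b k D y N); try assumption; lra.
      + apply Rmult_le_compat_r; [exact Hk|]; apply Rmult_le_compat_l; [exact HD|].
        apply Rle_trans with (log_part y).
        * pose proof (log_part_remainder y N); lra.
        * apply log_part_le; lra. }
  unfold bohr_inequality; rewrite HH.
  destruct (Rbar_plus _ _) as [s | |].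
  - simpl in *; apply le_epsilon; intros eps Heps; apply HB; lra.
  - apply (HB (H + 1)); lra.
  - exact I.
Qed.

(** * Sharpness *)

Fixpoint horner (n : nat) (c : nat -> C) (z : C) : C :=
  match n with
  | O => c 0%nat
  | S n' => (c 0%nat + z * horner n' (fun i => c (S i)) z)%C
  end.

Lemma power_series_cons (c : nat -> C) (w l : C) :
  is_power_series_from 0 (fun i => c (S i)) w l ->
  is_power_series_from 0 c w (c 0%nat + w * l)%C.
Proof.
  intros H; unfold is_power_series_from in *; simpl Nat.add in *.
  apply (is_series_decr_1 (K := C_AbsRing) (V := C_NormedModule)).
  change plus with Cplus; change opp with Copp.
  replace (c 0%nat + w * l + - (c 0%nat * w ^ 0))%C with (w * l)%C by (simpl; ring).
  apply (is_series_scal (K := C_AbsRing) (V := C_NormedModule) w) in H.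
  revert H; apply is_series_C_ext; intros n; change scal with Cmult; simpl; ring.
Qed.

Lemma power_series_0 (w : C) : is_power_series_from 0 (fun _ => RtoC 0) w (RtoC 0).
Proof.
  unfold is_power_series_from.
  apply (filterlim_ext (fun _ => RtoC 0)); [|apply filterlim_const].
  intros m; induction m as [|m IH].
  - rewrite sum_O; symmetry; apply Cmult_0_l.
  - rewrite sum_Sn, <- IH; change plus with Cplus; simpl; ring.
Qed.

Lemma power_series_const (c : nat -> C) (w : C) :
  (forall i, c (S i) = RtoC 0) -> is_power_series_from 0 c w (c 0%nat).
Proof.
  intros Hc; replace (c 0%nat) with (c 0%nat + w * 0)%C by ring.
  apply power_series_cons; generalize (power_series_0 w); apply is_series_C_ext.
  intros n; simpl; now rewrite Hc.
Qed.

Lemma power_series_plus (c d : nat -> C) (w k l : C) :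
  is_power_series_from 0 c w k -> is_power_series_from 0 d w l ->
  is_power_series_from 0 (fun i => (c i + d i)%C) w (k + l)%C.
Proof.
  intros Hc Hd.
  generalize (is_series_plus (K := C_AbsRing) (V := C_NormedModule) _ _ _ _ Hc Hd).
  apply is_series_C_ext; intros n; change plus with Cplus; simpl; ring.
Qed.

Lemma power_series_scal (a : C) (c : nat -> C) (w l : C) :
  is_power_series_from 0 c w l ->
  is_power_series_from 0 (fun i => (a * c i)%C) w (a * l)%C.
Proof.
  intros Hc.
  generalize (is_series_scal (K := C_AbsRing) (V := C_NormedModule) a _ _ Hc).
  apply is_series_C_ext; intros n; change scal with Cmult; simpl; ring.
Qed.

Lemma power_series_unique (c : nat -> C) (w k l : C) :
  is_power_series_from 0 c w k -> is_power_series_from 0 c w l -> k = l.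
Proof.
  apply (filterlim_locally_unique (K := C_AbsRing) (V := C_NormedModule)).
Qed.

Lemma horner_power_series (n : nat) : forall (c : nat -> C) (z : C),
  (forall i, (n < i)%nat -> c i = RtoC 0) ->
  is_power_series_from 0 c z (horner n c z).
Proof.
  induction n as [|n IH]; intros c z Hc.
  - apply power_series_const; intros i; apply Hc; lia.
  - apply power_series_cons, IH; intros i Hi; apply Hc; lia.
Qed.

(** Recentering at [z0]: multiplication by [z = z0 + w] acts on the
    coefficients in [w]. *)
Lemma horner_analytic (n : nat) (c : nat -> C) : analytic_in_disc (horner n c).
Proof.
  assert (Hloc : forall z0, forall n c, exists d, forall z,
            is_power_series_from 0 d (z - z0)%C (horner n c z)).
  { clear n c; intros z0; induction n as [|n IH]; intros c.
    - exists (const_coef (c 0%nat)); intros z.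
      now apply (power_series_const (const_coef (c 0%nat))).
    - destruct (IH (fun i => c (S i))) as [d Hd].
      exists (fun i => (const_coef (c 0%nat) i
                        + (z0 * d i + match i with O => RtoC 0 | S j => d j end))%C).
      intros z; specialize (Hd z); simpl horner.
      set (q := horner n (fun i => c (S i)) z) in *.
      replace (c 0%nat + z * q)%C
        with (c 0%nat + (z0 * q + (0 + (z - z0) * q)))%C by ring.
      apply power_series_plus; [now apply (power_series_const (const_coef (c 0%nat)))|].
      apply (power_series_plus (fun i => z0 * d i)%C); [now apply power_series_scal|].
      now apply (power_series_cons (fun i => match i with O => RtoC 0 | S j => d j end)). }
  intros z0 _; destruct (Hloc z0 n c) as [d Hd]; exists d, 1; split; [lra | auto].
Qed.

Lemma horner_last (n : nat) : forall (c : nat -> C) (z : C),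
  horner (S n) c z = (horner n c z + c (S n) * z ^ S n)%C.
Proof.
  induction n as [|n IH]; intros c z; [simpl; ring|].
  change (horner (S (S n)) c z) with (c 0%nat + z * horner (S n) (fun i => c (S i)) z)%C.
  rewrite IH; simpl; ring.
Qed.

Lemma horner_scal (n : nat) (a : C) : forall (c d : nat -> C) (z : C),
  (forall i, (i <= n)%nat -> c i = (a * d i)%C) -> horner n c z = (a * horner n d z)%C.
Proof.
  induction n as [|n IH]; intros c d z H; simpl; rewrite H by lia; [reflexivity|].
  rewrite (IH _ (fun i => d (S i))); [ring|]; intros i Hi; apply H; lia.
Qed.

Lemma horner_derive (n : nat) (c : nat -> C) (z : C) :
  (forall i, (S n < i)%nat -> c i = RtoC 0) ->
  C_derive (horner (S n) c) z = horner n (deriv_coef c) z.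
Proof.
  intros Hc.
  apply (power_series_unique (deriv_coef c) z).
  - rewrite <- (Cminus_0_r z) at 1.
    apply (power_series_derive (horner (S n) c) (RtoC 0) c (Cmod z + 1)).
    + intros y _; rewrite Cminus_0_r; now apply horner_power_series.
    + rewrite Cminus_0_r; lra.
  - apply horner_power_series; intros i Hi; unfold deriv_coef; rewrite Hc by lia; ring.
Qed.

(** * Monomials *)

Fixpoint monomial_coef (j : nat) : nat -> C :=
  match j with
  | O => const_coef (RtoC 1)
  | S j' => fun i => match i with O => RtoC 0 | S i' => monomial_coef j' i' end
  end.

Lemma horner_monomial (j : nat) (z : C) : horner j (monomial_coef j) z = (z ^ j)%C.
Proof.
  induction j as [|j IH]; [reflexivity|].
  change ((0 + z * horner j (monomial_coef j) z)%C = (z * z ^ j)%C); rewrite IH; ring.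
Qed.

Lemma monomial_coef_diag (j : nat) : monomial_coef j j = RtoC 1.
Proof. induction j; simpl; auto. Qed.

Lemma monomial_coef_off (j : nat) : forall i, i <> j -> monomial_coef j i = RtoC 0.
Proof.
  induction j as [|j IH]; intros [|i] Hi; simpl; trivial; try lia.
  apply IH; lia.
Qed.

Lemma sup_norm_le (f : C -> C) (B : R) :
  (forall z, Cmod z < 1 -> Cmod (f z) <= B) -> Rbar_le (sup_norm f) (Finite B).
Proof.
  intros H.
  destruct (Lub_Rbar_correct (fun x : R => exists z : C, in_disc z /\ x = Cmod (f z)))
    as [_ Hlub]; apply Hlub; intros x [z [Hz ->]]; exact (H z Hz).
Qed.

Lemma monomial_class_B_order (j : nat) :
  class_B_order j (horner j (monomial_coef j)).
Proof.
  assert (Hps : forall z, Cmod z < 1 ->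
            is_power_series_from 0 (monomial_coef j) z (horner j (monomial_coef j) z)).
  { intros z _; apply horner_power_series; intros i Hi; apply monomial_coef_off; lia. }
  split; [split|split].
  - apply horner_analytic.
  - apply sup_norm_le; intros z Hz; rewrite horner_monomial, Cmod_pow.
    rewrite <- (pow1 j); apply pow_incr; split; [apply Cmod_ge_0 | lra].
  - intros i Hi; apply (C_derive_n_at_center _ (monomial_coef j) 1); [lra | exact Hps |].
    apply monomial_coef_off; lia.
  - intros E; apply (C_derive_n_at_center _ (monomial_coef j) 1) in E; [|lra | exact Hps].
    rewrite monomial_coef_diag in E; apply RtoC_inj in E; lra.
Qed.

(** * Truncated Moebius transforms *)

(** Taylor coefficients of [(alpha - z) / (1 - alpha z)], cut off above
    degree [n + 1]. *)
Definition moebius_coef (alpha : R) (n i : nat) : C :=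
  match i with
  | O => RtoC alpha
  | S j => if Nat.leb j n then RtoC (- (1 - alpha ^ 2) * alpha ^ j) else RtoC 0
  end.

(** Coefficients of the primitive of [k z h'] vanishing at the origin, for
    [h] with the coefficients above. *)
Definition coanalytic_coef (k alpha : R) (n i : nat) : C :=
  match i with
  | O => RtoC 0
  | S O => RtoC 0
  | S (S j) => (RtoC (k * (INR (S j) / INR (S (S j)))) * moebius_coef alpha n (S j))%C
  end.

Lemma moebius_coef_in (alpha : R) (n j : nat) :
  (j <= n)%nat -> moebius_coef alpha n (S j) = RtoC (- (1 - alpha ^ 2) * alpha ^ j).
Proof. intros H; simpl; now rewrite (proj2 (Nat.leb_le _ _) H). Qed.

Lemma moebius_coef_out (alpha : R) (n i : nat) :
  (S n < i)%nat -> moebius_coef alpha n i = RtoC 0.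
Proof.
  destruct i as [|j]; [lia|]; intros H; simpl.
  rewrite (proj2 (Nat.leb_gt _ _)); [reflexivity | lia].
Qed.

Lemma coanalytic_coef_out (k alpha : R) (n i : nat) :
  (S (S n) < i)%nat -> coanalytic_coef k alpha n i = RtoC 0.
Proof.
  destruct i as [|[|j]]; try lia; intros H; unfold coanalytic_coef.
  rewrite moebius_coef_out by lia; ring.
Qed.

Lemma horner_moebius (alpha : R) (z : C) (n : nat) (c : nat -> C) :
  c 0%nat = RtoC alpha ->
  (forall j, (j <= n)%nat -> c (S j) = RtoC (- (1 - alpha ^ 2) * alpha ^ j)) ->
  ((1 - alpha * z) * horner (S n) c z
   = alpha - z + RtoC (1 - alpha ^ 2) * z * (alpha * z) ^ S n)%C.
Proof.
  intros H0; induction n as [|n IH]; intros H.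
  - simpl; rewrite H0, (H 0%nat) by lia; simpl.
    rewrite !RtoC_mult, RtoC_opp, !RtoC_minus, !RtoC_mult; ring.
  - rewrite horner_last, Cmult_plus_distr_l, IH by (intros j Hj; apply H; lia).
    rewrite (H (S n)) by lia.
    rewrite RtoC_mult, RtoC_opp, RtoC_minus, !RtoC_pow, Cpow_mult_l.
    rewrite !(Cpow_mult_l (RtoC alpha)); simpl; ring.
Qed.

Lemma horner_moebius_derive (alpha : R) (z : C) (n : nat) (c : nat -> C) :
  (forall j, (j <= n)%nat -> c j = RtoC (INR (S j) * alpha ^ j)) ->
  ((1 - alpha * z) ^ 2 * horner n c z
   = 1 - INR (S (S n)) * (alpha * z) ^ S n + INR (S n) * (alpha * z) ^ S (S n))%C.
Proof.
  induction n as [|n IH]; intros H.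
  - simpl horner; rewrite (H 0%nat) by lia; simpl.
    rewrite !RtoC_plus, !Rmult_1_l; ring.
  - rewrite horner_last, Cmult_plus_distr_l, IH by (intros j Hj; apply H; lia).
    rewrite (H (S n)) by lia.
    rewrite (S_INR (S (S n))), (S_INR (S n)), RtoC_mult, !RtoC_plus, RtoC_pow.
    rewrite !(Cpow_mult_l (RtoC alpha)); simpl Cpow; ring.
Qed.

Lemma moebius_disc_bound (alpha : R) (z : C) :
  0 <= alpha < 1 -> Cmod z < 1 -> Cmod (alpha - z) <= Cmod (1 - alpha * z).
Proof.
  intros Ha Hz; apply Rsqr_incr_0_var; [|apply Cmod_ge_0].
  rewrite !Rsqr_pow2.
  assert (Hz2 : Cmod z ^ 2 <= 1).
  { rewrite <- (pow1 2); apply pow_incr; split; [apply Cmod_ge_0 | lra]. }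
  revert Hz2; destruct z as [x y].
  unfold Cminus, Cplus, Cmult, Copp, RtoC; simpl fst; simpl snd.
  rewrite !Cmod_sqr; intros Hz2.
  assert (0 <= (1 - alpha ^ 2) * (1 - (x ^ 2 + y ^ 2))) by (apply Rmult_le_pos; nra).
  nra.
Qed.

Lemma one_minus_lower (alpha : R) (z : C) :
  0 <= alpha < 1 -> Cmod z < 1 -> 1 - alpha <= Cmod (1 - alpha * z).
Proof.
  intros Ha Hz; pose proof (Cmod_triangle_inv 1 (- (alpha * z))) as T.
  rewrite Cmod_1, Cmod_opp, Cmod_mult, Cmod_R, Rabs_pos_eq in T by lra.
  unfold Cminus; nra.
Qed.

Lemma moebius_truncation_bound (alpha : R) (n : nat) (z : C) :
  0 <= alpha < 1 -> Cmod z < 1 ->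
  Cmod (horner (S n) (moebius_coef alpha n) z) <= 1 + 2 * alpha ^ S n.
Proof.
  intros Ha Hz.
  pose proof (horner_moebius alpha z n (moebius_coef alpha n) eq_refl
                (fun j Hj => moebius_coef_in alpha n j Hj)) as E.
  apply (f_equal Cmod) in E; rewrite Cmod_mult in E.
  pose proof (Cmod_triangle (alpha - z) (RtoC (1 - alpha ^ 2) * z * (alpha * z) ^ S n)) as T.
  rewrite <- E, !Cmod_mult, Cmod_pow, Cmod_mult, !Cmod_R in T.
  rewrite !Rabs_pos_eq in T by nra.
  pose proof (moebius_disc_bound alpha z Ha Hz) as H1.
  pose proof (one_minus_lower alpha z Ha Hz) as H2.
  pose proof (Cmod_ge_0 z) as Hz0.
  assert (H3 : (alpha * Cmod z) ^ S n <= alpha ^ S n).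
  { apply pow_incr; split; [apply Rmult_le_pos; lra | nra]. }
  assert (H4 : 0 <= alpha ^ S n) by (apply pow_le; lra).
  assert (H5 : 0 <= (alpha * Cmod z) ^ S n) by (apply pow_le, Rmult_le_pos; lra).
  set (A := (alpha * Cmod z) ^ S n) in *; set (A' := alpha ^ S n) in *.
  assert (H6 : (1 - alpha ^ 2) * Cmod z * A <= (1 - alpha) * (2 * A')).
  { replace ((1 - alpha) * (2 * A')) with ((1 - alpha) * 2 * A') by ring.
    apply Rmult_le_compat; try assumption.
    - apply Rmult_le_pos; nra.
    - replace ((1 - alpha ^ 2) * Cmod z) with ((1 - alpha) * ((1 + alpha) * Cmod z)) by ring.
      apply Rmult_le_compat_l; nra. }
  apply Rmult_le_reg_l with (Cmod (1 - alpha * z)); [lra|].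
  assert ((1 - alpha) * (2 * A') <= Cmod (1 - alpha * z) * (2 * A'))
    by (apply Rmult_le_compat_r; lra).
  nra.
Qed.

(** Up to a factor, the derivative times [(1 - u)^2], with [u = alpha z], is
    [1 - (n+2) u^(n+1) + (n+1) u^(n+2)], a small perturbation of [1]. *)
Lemma moebius_truncation_derive_neq0 (alpha : R) (n : nat) (z : C) :
  0 < alpha < 1 -> Cmod z < 1 -> (INR (S (S n)) + INR (S n)) * alpha ^ S n < 1 ->
  C_derive (horner (S n) (moebius_coef alpha n)) z <> RtoC 0.
Proof.
  intros Ha Hz Hn.
  rewrite horner_derive by (intros i Hi; now apply moebius_coef_out).
  rewrite (horner_scal n (RtoC (- (1 - alpha ^ 2))) _
             (fun j => RtoC (INR (S j) * alpha ^ j))).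
  2:{ intros j Hj; unfold deriv_coef; rewrite moebius_coef_in by exact Hj.
      rewrite <- !RtoC_mult; f_equal; ring. }
  intros E; rewrite Cmult_comm in E; apply Cmult_eq_0_l in E.
  2:{ intros E'; apply RtoC_inj in E'; nra. }
  pose proof (horner_moebius_derive alpha z n _ (fun j _ => eq_refl)) as H.
  rewrite E, Cmult_0_r in H.
  assert (H1 : RtoC 1 = (INR (S (S n)) * (alpha * z) ^ S n
                         + - (INR (S n) * (alpha * z) ^ S (S n)))%C).
  { transitivity (RtoC 1 - 0)%C; [ring | rewrite H; ring]. }
  apply (f_equal Cmod) in H1; rewrite Cmod_1 in H1.
  pose proof (Cmod_triangle (INR (S (S n)) * (alpha * z) ^ S n)
                (- (INR (S n) * (alpha * z) ^ S (S n)))) as T.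
  rewrite <- H1, Cmod_opp, !Cmod_mult, !Cmod_pow, !Cmod_mult, !Cmod_R in T.
  rewrite (Rabs_pos_eq alpha), !Rabs_pos_eq in T by (try apply pos_INR; lra).
  pose proof (Cmod_ge_0 z).
  assert (Hu : 0 <= alpha * Cmod z <= alpha) by nra.
  assert (H3 : (alpha * Cmod z) ^ S n <= alpha ^ S n) by (now apply pow_incr).
  assert (H4 : 0 <= (alpha * Cmod z) ^ S n) by (apply pow_le; lra).
  assert (H5 : (alpha * Cmod z) ^ S (S n) <= (alpha * Cmod z) ^ S n).
  { change ((alpha * Cmod z) * (alpha * Cmod z) ^ S n <= (alpha * Cmod z) ^ S n); nra. }
  pose proof (pos_INR (S n)); pose proof (pos_INR (S (S n))).
  set (A := (alpha * Cmod z) ^ S n) in *; set (A2 := (alpha * Cmod z) ^ S (S n)) in *.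
  assert (INR (S (S n)) * A <= INR (S (S n)) * alpha ^ S n)
    by (apply Rmult_le_compat_l; lra).
  assert (INR (S n) * A2 <= INR (S n) * alpha ^ S n) by (apply Rmult_le_compat_l; lra).
  lra.
Qed.

Lemma coanalytic_derive (k alpha : R) (n : nat) (z : C) :
  C_derive (horner (S (S n)) (coanalytic_coef k alpha n)) z
  = (k * z * C_derive (horner (S n) (moebius_coef alpha n)) z)%C.
Proof.
  rewrite horner_derive by (intros i Hi; now apply coanalytic_coef_out).
  rewrite horner_derive by (intros i Hi; now apply moebius_coef_out).
  change (horner (S n) (deriv_coef (coanalytic_coef k alpha n)) z)
    with (deriv_coef (coanalytic_coef k alpha n) 0
          + z * horner n (fun i => deriv_coef (coanalytic_coef k alpha n) (S i)) z)%C.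
  rewrite (horner_scal n (RtoC k) _ (deriv_coef (moebius_coef alpha n))).
  - assert (E : deriv_coef (coanalytic_coef k alpha n) 0 = RtoC 0)
      by (unfold deriv_coef; simpl; ring).
    rewrite E; ring.
  - intros i Hi; unfold deriv_coef, coanalytic_coef.
    assert (0 < INR (S (S i))) by (apply lt_0_INR; lia).
    rewrite !Cmult_assoc, <- !RtoC_mult; f_equal; f_equal; field; lra.
Qed.

(** * Choice of the parameters *)

Lemma linear_times_power_small (x eps : R) (N : nat) :
  0 < x < 1 -> 0 < eps -> exists n, (N <= n)%nat /\ INR n * x ^ n < eps.
Proof.
  intros Hx Heps.
  set (t := (1 + x) / 2); assert (Ht : x < t < 1) by (unfold t; lra).
  set (A := x / (t - x)); assert (HA : 0 < A) by (apply Rdiv_lt_0_compat; lra).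
  destruct (pow_lt_1_zero t) with (y := eps / A) as [M HM].
  - rewrite Rabs_pos_eq; lra.
  - now apply Rdiv_lt_0_compat.
  - exists (Nat.max N M); split; [lia|].
    assert (H1 : INR (Nat.max N M) * x ^ Nat.max N M <= A * t ^ Nat.max N M)
      by (apply linear_growth; lra).
    specialize (HM (Nat.max N M) (Nat.le_max_r N M)).
    rewrite Rabs_pos_eq in HM by (apply pow_le; lra).
    apply Rmult_lt_compat_l with (r := A) in HM; [|exact HA].
    replace (A * (eps / A)) with eps in HM by (field; lra); lra.
Qed.

Lemma partial_sums_above_half (p m : nat) (k rho : R) :
  (1 <= p)%nat -> (1 <= m)%nat -> 0 <= k < 1 -> 0 < rho < 1 ->
  0 < radius_eq_lhs p m k rho ->
  exists N, / 2 < sum_f_R0 (fun i => (rho ^ p) ^ S i) N + k * log_part_sum (rho ^ m) N.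
Proof.
  intros Hp Hm Hk Hrho Hpos; rewrite radius_eq_lhs_alt in Hpos.
  assert (Hle : forall q, (1 <= q)%nat -> 0 <= rho ^ q <= rho).
  { intros [|q] Hq; [lia|]; split; [apply pow_le; lra|].
    assert (rho ^ q <= 1) by (rewrite <- (pow1 q); apply pow_incr; lra).
    simpl; nra. }
  pose proof (Hle p Hp) as HX; pose proof (Hle m Hm) as HY.
  set (X := rho ^ p) in *; set (Y := rho ^ m) in *.
  set (gap := X / (1 - X) + k * log_part Y - / 2).
  assert (Hgap : 0 < gap) by (unfold gap; lra).
  assert (Hr2 : 0 < (1 - rho) ^ 2) by (apply pow_lt; lra).
  destruct (linear_times_power_small rho (gap * (1 - rho) ^ 2 / 2) 2) as [n [Hn Hsmall]];
    [lra | |].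
  { apply Rdiv_lt_0_compat; [now apply Rmult_lt_0_compat | lra]. }
  destruct n as [|[|N]]; try lia; exists N.
  assert (Hgeom : sum_f_R0 (fun i => X ^ S i) N = (X - X ^ S (S N)) / (1 - X)).
  { clear -HX Hrho; induction N as [|N IH]; [simpl; field; lra|].
    rewrite tech5, IH; simpl pow; field; lra. }
  pose proof (log_part_remainder Y N) as Hrem.
  set (E := INR (S (S N)) * rho ^ S (S N)) in *.
  assert (HN1 : 1 <= INR (S (S N))) by (apply (le_INR 1); lia).
  assert (Hrp : 0 <= rho ^ S (S N)) by (apply pow_le; lra).
  assert (HEX : X ^ S (S N) / (1 - X) <= E / (1 - rho) ^ 2).
  { assert (HXp : 0 <= X ^ S (S N) <= E).
    { split; [apply pow_le; lra|]; unfold E.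
      assert (X ^ S (S N) <= rho ^ S (S N)) by (apply pow_incr; lra); nra. }
    apply Rmult_le_compat; [lra | apply Rlt_le, Rinv_0_lt_compat; lra | lra |].
    apply Rinv_le_contravar; [exact Hr2 | nra]. }
  assert (HEY : INR (S (S N)) * Y ^ S (S N) / (1 - Y) ^ 2 <= E / (1 - rho) ^ 2).
  { assert (HYp : 0 <= Y ^ S (S N) <= rho ^ S (S N)).
    { split; [apply pow_le; lra | apply pow_incr; lra]. }
    assert (HY2 : (1 - rho) ^ 2 <= (1 - Y) ^ 2) by (apply pow_incr; lra).
    apply Rmult_le_compat; [apply Rmult_le_pos; lra | apply Rlt_le, Rinv_0_lt_compat; lra | |].
    - unfold E; apply Rmult_le_compat_l; lra.
    - apply Rinv_le_contravar; lra. }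
  assert (HE : E / (1 - rho) ^ 2 < gap / 2).
  { apply Rcomplements.Rlt_div_l; [exact Hr2 | lra]. }
  rewrite Hgeom.
  replace ((X - X ^ S (S N)) / (1 - X)) with (X / (1 - X) - X ^ S (S N) / (1 - X))
    by (field; lra).
  assert (0 <= E / (1 - rho) ^ 2).
  { apply Rcomplements.Rdiv_le_0_compat; [apply Rmult_le_pos; lra | exact Hr2]. }
  assert (k * (log_part Y - log_part_sum Y N) <= gap / 2) by nra.
  unfold gap in *; lra.
Qed.

(** As [alpha] tends to [1], the product tends to [2 S0], which exceeds [1]. *)
Lemma alpha_exists (S0 : R) (N : nat) :
  / 2 < S0 -> exists alpha, 0 < alpha < 1 /\ 1 < (1 + alpha) * alpha ^ N * S0.
Proof.
  intros HS.
  set (L := 2 * INR N + 1).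
  assert (HL : 1 <= L) by (pose proof (pos_INR N); unfold L; lra).
  set (d := Rmin (/ 2) ((2 * S0 - 1) / (2 * (L * S0)))).
  assert (Hd0 : 0 < d).
  { apply Rmin_glb_lt; [lra|]; apply Rdiv_lt_0_compat; nra. }
  assert (Hd1 : d <= / 2) by apply Rmin_l.
  assert (Hd2 : d * (L * S0) <= (2 * S0 - 1) / 2).
  { assert (H : d <= (2 * S0 - 1) / (2 * (L * S0))) by apply Rmin_r.
    apply Rmult_le_compat_r with (r := L * S0) in H; [|nra].
    replace ((2 * S0 - 1) / (2 * (L * S0)) * (L * S0)) with ((2 * S0 - 1) / 2) in H
      by (field; nra); exact H. }
  exists (1 - d); split; [lra|].
  assert (HB : 1 - INR N * d <= (1 - d) ^ N) by (apply bernoulli_below; lra).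
  assert (H1 : 2 - d * L <= (1 + (1 - d)) * (1 - d) ^ N).
  { pose proof (pos_INR N).
    apply Rle_trans with ((1 + (1 - d)) * (1 - INR N * d)).
    - unfold L; nra.
    - apply Rmult_le_compat_l; lra. }
  apply Rlt_le_trans with ((2 - d * L) * S0).
  - replace ((2 - d * L) * S0) with (2 * S0 - d * (L * S0)) by ring; lra.
  - apply Rmult_le_compat_r; lra.
Qed.

Lemma Lim_seq_ge_partial (u : nat -> R) (N : nat) :
  (forall i, 0 <= u i) -> Rbar_le (sum_f_R0 u N) (Lim_seq (sum_n u)).
Proof.
  intros Hu; rewrite <- (Lim_seq_const (sum_f_R0 u N)); apply Lim_seq_le_loc.
  exists N; intros n Hn; rewrite sum_n_Reals.
  induction Hn as [|n Hn IH]; [lra|]; simpl; specialize (Hu (S n)); lra.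
Qed.

(** The disc automorphism [h(z) = (alpha - z)/(1 - alpha z)] with dilatation
    [k z] attains equality in all the estimates in the limit [alpha -> 1].
    Truncating its Taylor series makes both [h] and [g] polynomials, at the
    price of raising the norm of [h] to [1 + 2 alpha^(n+1)]; a finite excess of
    the sums over [1] survives this for large [n]. *)
Lemma bohr_inequality_sharp (K k : R) (p m : nat) (rho : R) :
  k = (K - 1) / (K + 1) -> 0 <= k < 1 -> (1 <= p)%nat -> (1 <= m)%nat ->
  0 < rho < 1 -> 0 < radius_eq_lhs p m k rho ->
  exists (f h g : C -> C) (a b : nat -> C) (omega : nat -> C -> C) (z : C),
    sense_preserving_qc_harmonic K f h g /\
    has_expansions h g a b /\
    bounded_in_disc h /\
    (forall j : nat, (1 <= j)%nat -> class_B_order j (omega j)) /\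
    Cmod z <= rho /\
    ~ bohr_inequality h a b (Cmod (omega p z)) (Cmod (omega m z)).
Proof.
  intros HkK Hk Hp Hm Hrho Hpos.
  destruct (partial_sums_above_half p m k rho Hp Hm Hk Hrho Hpos) as [N HN].
  set (S0 := sum_f_R0 (fun i => (rho ^ p) ^ S i) N + k * log_part_sum (rho ^ m) N) in HN.
  destruct (alpha_exists S0 N HN) as [alpha [Ha HaS]].
  set (eps := (1 - alpha) * ((1 + alpha) * alpha ^ N * S0 - 1)).
  assert (Heps : 0 < eps) by (apply Rmult_lt_0_compat; lra).
  destruct (linear_times_power_small alpha (Rmin 1 eps / 3) (S N)) as [n' [Hn' Hsmall]];
    [exact Ha | |].
  { apply Rdiv_lt_0_compat; [apply Rmin_glb_lt; lra | lra]. }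
  destruct n' as [|n]; [lia|].
  pose proof (Rmin_l 1 eps); pose proof (Rmin_r 1 eps).
  assert (Hap : 0 <= alpha ^ S n) by (apply pow_le; lra).
  assert (Hn1 : 1 <= INR (S n)) by (apply (le_INR 1); lia).
  set (a := moebius_coef alpha n); set (b := coanalytic_coef k alpha n).
  set (h := horner (S n) a); set (g := horner (S (S n)) b).
  assert (Hh0 : forall z, Cmod z < 1 -> C_derive h z <> RtoC 0).
  { intros z Hz; apply moebius_truncation_derive_neq0; [exact Ha | exact Hz |].
    rewrite (S_INR (S n)); nra. }
  assert (Hg' : forall z, C_derive g z = (k * z * C_derive h z)%C)
    by (intros z; apply coanalytic_derive).
  assert (Hhb : forall z, Cmod z < 1 -> Cmod (h z) <= 1 + 2 * alpha ^ S n).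
  { intros z Hz; apply moebius_truncation_bound; [lra | exact Hz]. }
  assert (Hzr : Cmod (RtoC rho) = rho) by (rewrite Cmod_R; apply Rabs_pos_eq; lra).
  exists (fun z => h z + Cconj (g z))%C, h, g, a, b,
    (fun j => horner j (monomial_coef j)), (RtoC rho).
  split; [split; [split; [split; [|split]|]|]|split; [|split; [|split; [|split]]]].
  - apply horner_analytic.
  - apply horner_analytic.
  - reflexivity.
  - intros z Hz; unfold in_disc in Hz; rewrite Hg', !Cmod_mult, Cmod_R, Rabs_pos_eq by lra.
    specialize (Hh0 z Hz); apply Cmod_gt_0 in Hh0.
    pose proof (Cmod_ge_0 z).
    assert (Hkz : 0 <= k * Cmod z < 1) by nra.
    rewrite Rpow_mult_distr.
    assert (0 < Cmod (C_derive h z) ^ 2) by (apply pow_lt; exact Hh0).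
    assert ((k * Cmod z) ^ 2 < 1) by nra.
    nra.
  - intros z Hz; unfold in_disc in Hz; rewrite Hg', <- HkK.
    replace (k * z * C_derive h z / C_derive h z)%C with (k * z)%C by (field; auto).
    rewrite Cmod_mult, Cmod_R, Rabs_pos_eq by lra; nra.
  - intros z Hz; split.
    + apply horner_power_series; intros i Hi; now apply moebius_coef_out.
    + assert (Hg2 : is_power_series_from 0 b z (g z)).
      { apply horner_power_series; intros i Hi; now apply coanalytic_coef_out. }
      unfold is_power_series_from in *; simpl Nat.add in *.
      pose (u := fun i => (b i * z ^ i)%C).
      apply (is_series_incr_1 (K := C_AbsRing) (V := C_NormedModule) (fun i => u (S i))).
      apply (is_series_incr_1 (K := C_AbsRing) (V := C_NormedModule) u).
      change plus with Cplus.
      replace (g z + u 1%nat + u 0%nat)%C with (g z) by (unfold u, b; simpl; ring).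
      exact Hg2.
  - exists (1 + 2 * alpha ^ S n); exact Hhb.
  - intros j _; apply monomial_class_B_order.
  - lra.
  - rewrite !horner_monomial, !Cmod_pow, Hzr.
    set (X := rho ^ p) in *; set (Y := rho ^ m) in *.
    assert (HX : 0 <= X) by (apply pow_le; lra).
    assert (HY : 0 <= Y) by (apply pow_le; lra).
    intros Hbohr; unfold bohr_inequality in Hbohr.
    pose proof (Rbar_le_trans _ _ _ Hbohr (sup_norm_le h _ Hhb)) as Hup.
    set (s1 := sum_f_R0 (fun i => Cmod (a (0 + i)%nat) * X ^ (0 + i)) (S N)).
    set (s2 := sum_f_R0 (fun i => Cmod (b (2 + i)%nat) * Y ^ (2 + i)) N).
    assert (Hlow : Rbar_le (Finite (s1 + s2))
              (Rbar_plus (abs_power_series_from 0 a X) (abs_power_series_from 2 b Y))).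
    { apply (Rbar_plus_le_compat (Finite s1) _ (Finite s2));
        apply Lim_seq_ge_partial; intros i;
        (apply Rmult_le_pos; [apply Cmod_ge_0 | now apply pow_le]). }
    pose proof (Rbar_le_trans _ _ _ Hlow Hup) as Hfin.
    change (s1 + s2 <= 1 + 2 * alpha ^ S n) in Hfin.
    set (w := (1 - alpha ^ 2) * alpha ^ N).
    assert (Ha2 : 0 <= 1 - alpha ^ 2) by nra.
    assert (HaN : forall i, (i <= N)%nat -> w <= Cmod (a (S i))).
    { intros i Hi; unfold a; rewrite moebius_coef_in by lia.
      rewrite Cmod_R, Ropp_mult_distr_l_reverse, Rabs_Ropp, Rabs_pos_eq
        by (apply Rmult_le_pos; [exact Ha2 | apply pow_le; lra]).
      apply Rmult_le_compat_l; [exact Ha2|].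
      replace N with (i + (N - i))%nat by lia; rewrite pow_add.
      assert (0 <= alpha ^ i) by (apply pow_le; lra).
      assert (alpha ^ (N - i) <= 1) by (rewrite <- (pow1 (N - i)); apply pow_incr; lra).
      nra. }
    assert (H1 : alpha + w * sum_f_R0 (fun i => X ^ S i) N <= s1).
    { unfold s1; rewrite (decomp_sum _ (S N)) by lia; simpl pred.
      rewrite scal_sum; apply Rplus_le_compat.
      - simpl; rewrite Cmod_R, Rabs_pos_eq by lra; lra.
      - apply sum_Rle; intros i Hi; rewrite Rmult_comm.
        apply Rmult_le_compat_r; [now apply pow_le | now apply HaN]. }
    assert (H2 : w * (k * log_part_sum Y N) <= s2).
    { unfold s2, log_part_sum; rewrite <- Rmult_assoc, scal_sum.
      apply sum_Rle; intros i Hi; unfold b.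
      change (coanalytic_coef k alpha n (2 + i))
        with (RtoC (k * (INR (S i) / INR (S (S i)))) * a (S i))%C.
      assert (Hc : 0 <= k * (INR (S i) / INR (S (S i)))).
      { apply Rmult_le_pos; [lra|].
        apply Rcomplements.Rdiv_le_0_compat; [apply pos_INR | apply lt_0_INR; lia]. }
      rewrite Cmod_mult, Cmod_R, Rabs_pos_eq by exact Hc.
      assert (HYp : 0 <= Y ^ (2 + i)) by now apply pow_le.
      replace (INR (S i) / INR (S (S i)) * Y ^ S (S i) * (w * k))
        with (k * (INR (S i) / INR (S (S i))) * w * Y ^ (2 + i)) by (simpl Nat.add; ring).
      apply Rmult_le_compat_r; [exact HYp|].
      apply Rmult_le_compat_l; [exact Hc | now apply HaN]. }
    assert (H3 : alpha + w * S0 <= s1 + s2) by (unfold S0; lra).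
    assert (H4 : alpha + w * S0 = 1 + eps) by (unfold w, eps; ring).
    assert (H5 : alpha ^ S n <= INR (S n) * alpha ^ S n) by nra.
    lra.
Qed.

Theorem theorem3p1 :
  forall (K k : R) (p m : nat),
    1 <= K -> k = (K - 1) / (K + 1) -> (1 <= p)%nat -> (1 <= m)%nat ->
    (exists r : R, is_smallest_root p m k r) /\
    forall r : R, is_smallest_root p m k r ->
      (forall (f h g : C -> C) (a b : nat -> C) (omega : nat -> C -> C),
          sense_preserving_qc_harmonic K f h g ->
          has_expansions h g a b ->
          bounded_in_disc h ->
          (forall j : nat, (1 <= j)%nat -> class_B_order j (omega j)) ->
          forall z : C, Cmod z <= Rmin r (1 / Rpower 3 (1 / INR m)) ->
            bohr_inequality h a b (Cmod (omega p z)) (Cmod (omega m z)))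
      /\
      (r <= 1 / Rpower 3 (1 / INR m) ->
       forall rho : R, r < rho < 1 ->
         exists (f h g : C -> C) (a b : nat -> C) (omega : nat -> C -> C) (z : C),
           sense_preserving_qc_harmonic K f h g /\
           has_expansions h g a b /\
           bounded_in_disc h /\
           (forall j : nat, (1 <= j)%nat -> class_B_order j (omega j)) /\
           Cmod z <= rho /\
           ~ bohr_inequality h a b (Cmod (omega p z)) (Cmod (omega m z))).
Proof.
  intros K k p m HK HkK Hp Hm.
  assert (Hk : 0 <= k < 1).
  { rewrite HkK; split; [apply Rcomplements.Rdiv_le_0_compat; lra|].
    apply Rcomplements.Rlt_div_l; lra. }
  split; [now apply radius_eq_root_exists|].
  intros r Hr; split.
  - intros f h g a b omega Hqc Hexp Hbd Hom z Hz.
    now apply (bohr_inequality_below_radius K k p m r f h g a b omega z).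
  - intros _ rho Hrho.
    destruct Hr as [Hr01 [Hroot _]].
    apply (bohr_inequality_sharp K k p m rho); try assumption; [lra|].
    rewrite <- Hroot; apply radius_eq_lhs_lt; try assumption; lra.
Qed.
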